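(* Let $\Delta$ be a connected affine root system with simple roots $\Pi=\{\alpha_0,\dots,\alpha_n\}$, and for $t\in\mathbb{N}$ let $\Delta^t=\{\alpha\in\Delta\mid t \text{ divides }(\alpha,\alpha)\}$. Then all $\Delta^t$ are equal to $\Delta$ or consist only of isotropic roots, except in the following cases, in which $\Delta^t$ is of the indicated type with set of positive simple roots $\Pi^t$: - $B_n^{(1)}$, $t=4$: $\Delta^t=D_n^{(1)}$, $\Pi^t=\{\alpha_0,\alpha_1,\dots,\alpha_{n-1},\ \alpha_{n-1}+2\alpha_n\}$. - $C_n^{(1)}$, $t=4$: $\Delta^t=(A_1^{(1)})^{\times n}$, $\Pi^t=\{\alpha_n,\ \alpha_n+2\alpha_{n-1},\ \dots,\ \alpha_n+2\alpha_{n-1}+\dots+2\alpha_1\}\cup\{\alpha_0,\ \alpha_0+2\alpha_1,\ \dots,\ \alpha_0+2\alpha_1+\dots+2\alpha_{n-1}\}$. - $F_4^{(1)}$, $t=4$: $\Delta^t=D_4^{(1)}$, $\Pi^t=\{\alpha_0,\alpha_1,\alpha_2,\ \alpha_2+2\alpha_3,\ \alpha_2+2\alpha_3+2\alpha_4\}$. - $G_2^{(1)}$, $t=3,6$: $\Delta^t=A_2^{(1)}$, $\Pi^t=\{\alpha_0,\alpha_1,\ \alpha_1+3\alpha_2\}$. - $D_{n+1}^{(2)}$, $t=4$: $\Delta^t=D_n^{(1)}$, $\Pi^t=\{\alpha_0',\alpha_1,\dots,\alpha_{n-1},\ \alpha_{n-1}+2\alpha_n\}$ with $\alpha_0'=2\alpha_0+\alpha_1$.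 - $A_{2n-1}^{(2)}$, $t=4$: $\Delta^t=(A_1^{(1)})^{\times n}$, $\Pi^t=\{\alpha_n,\ \alpha_n+2\alpha_{n-1},\ \dots,\ \alpha_n+2\alpha_{n-1}+\dots+2\alpha_1\}\cup\{\alpha_0',\ \alpha_0'+2\alpha_1,\ \dots,\ \alpha_0'+2\alpha_1+\dots+2\alpha_{n-1}\}$ with $\alpha_0'=2\alpha_0+2\alpha_2+2\alpha_3+\dots+2\alpha_{n-1}+\alpha_n$. - $E_6^{(2)}$, $t=4$: $\Delta^t=D_4^{(1)}$, $\Pi^t=\{\alpha_0',\alpha_4,\alpha_3,\ \alpha_3+2\alpha_2,\ \alpha_3+2\alpha_2+2\alpha_1\}$ with $\alpha_0'=2\alpha_0+2\alpha_1+2\alpha_2+\alpha_3$. - $D_4^{(3)}$, $t=3,6$: $\Delta^t=A_2^{(1)}$, $\Pi^t=\{\alpha_0',\alpha_2,\ \alpha_2+3\alpha_1\}$ with $\alpha_0'=3\alpha_0+3\alpha_1+\alpha_2$. - $A_2^{(2)}$, $t=4,8$: $\Delta^t=A_1^{(1)}$, $\Pi^t=\{4\alpha_0+\alpha_1,\ \alpha_1\}$. - $A_{2n}^{(2)}$, $t=4$: $\Delta^t=A_{2n-1}^{(2)}$, $\Pi^t=\{\alpha_0',\alpha_1,\dots,\alpha_n\}$ with $\alpha_0'=2\alpha_0+\alpha_1$. - $A_{2n}^{(2)}$, $t=8$: $\Delta^t=(A_1^{(1)})^{\times n}$, $\Pi^t=\{\alpha_n,\ \alpha_n+2\alpha_{n-1},\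 \dots,\ \alpha_n+2\alpha_{n-1}+\dots+2\alpha_1\}\cup\{\alpha_0'',\ \alpha_0''+2\alpha_1,\ \dots,\ \alpha_0''+2\alpha_1+\dots+2\alpha_{n-1}\}$ with $\alpha_0'=2\alpha_0+\alpha_1$ and $\alpha_0''=2\alpha_0'+2\alpha_2+2\alpha_3+\dots+2\alpha_{n-1}+\alpha_n$. Moreover this choice of $\Pi^t$ is minimal in the sense that every element of $\Pi^t$, written in the basis $\Pi$, contains precisely one simple root from $\Delta^t\cap\Pi$, and this one only with multiplicity one.
   Context: Affine root systems are named as in Kac's book. The form $(\cdot,\cdot)$ is normalized so that the shortest real roots have $(\alpha,\alpha)=2$. $\Delta$ consists of the real roots (Weyl orbits of simple roots) and the isotropic roots $\mathbb{Z}\delta\setminus\{0\}$, $(\delta,\delta)=0$. By convention isotropic roots lie in every $\Delta^t$, and the types are determined without considering the isotropic roots, i.e. on the level of real roots, up to a rescaling of the form. In a product $(A_1^{(1)})^{\times n}$ all factors share the same isotropic roots, so $\Pi^t$ may be linearly dependent. Simple roots $\alpha_0,\dots,\alpha_n$ are numbered as follows (adjacent simple roots satisfy $(\alpha_i,\alpha_j)=-\tfrac12\max\{(\alpha_i,\alpha_i),(\alpha_j,\alpha_j)\}$, except $A_1^{(1)}$ where both roots have length $2$ and $(\alpha_0,\alpha_1)=-2$; nonadjacent ones are orthogonal; ''length'' means $(\alpha,\alpha)$): - $A_n^{(1)}$ ($n\ge2$, a cycle), $D_n^{(1)}$ ($n\ge4$), $E_{6,7,8}^{(1)}$: simply-laced,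 all lengths $2$; $D_3^{(1)}:=A_3^{(1)}$. - $B_n^{(1)}$, $n\ge3$: chain $\alpha_1-\dots-\alpha_n$, with $\alpha_0$ attached to $\alpha_2$; $\alpha_n$ has length $2$, the others $4$. - $C_n^{(1)}$, $n\ge2$: chain $\alpha_0-\dots-\alpha_n$; $\alpha_0,\alpha_n$ have length $4$, the others $2$. - $F_4^{(1)}$: chain $\alpha_0-\dots-\alpha_4$; $\alpha_0,\alpha_1,\alpha_2$ of length $4$, $\alpha_3,\alpha_4$ of length $2$. - $G_2^{(1)}$: chain $\alpha_0-\alpha_1-\alpha_2$; lengths $6,6,2$. - $D_{n+1}^{(2)}$, $n\ge2$: chain $\alpha_0-\dots-\alpha_n$; $\alpha_0,\alpha_n$ of length $2$, the others $4$. (No separate definition of the symbol $D_n^{(1)}$ for $n=2$ is given.) - $A_{2n-1}^{(2)}$, $n\ge3$: chain $\alpha_1-\dots-\alpha_n$, with $\alpha_0$ attached to $\alpha_2$; $\alpha_n$ of length $4$, the others $2$. For $n=2$ the symbol $A_3^{(2)}$ is read as $D_3^{(2)}$. - $E_6^{(2)}$: chain $\alpha_0-\dots-\alpha_4$; $\alpha_0,\alpha_1,\alpha_2$ of length $2$, $\alpha_3,\alpha_4$ of length $4$. - $D_4^{(3)}$: chain $\alpha_0-\alpha_1-\alpha_2$; lengths $2,2,6$. - $A_2^{(2)}$: $\alpha_0$ of length $2$, $\alpha_1$ of length $8$, $(\alpha_0,\alpha_1)=-4$. - $A_{2n}^{(2)}$, $n\ge2$: chain $\alpha_0-\dots-\alpha_n$;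 $\alpha_0$ of length $2$, $\alpha_1,\dots,\alpha_{n-1}$ of length $4$, $\alpha_n$ of length $8$.
   Formalization: For $D_{n+1}^{(2)}$ with $n=2$, $t=4$, where $D_2^{(1)}$ is undefined and the printed $\Pi^t$ misses a simple root, the type is taken as $(A_1^{(1)})^{\times 2}$ with $\Pi^t=\{\alpha_1,\alpha_1+2\alpha_2,\alpha_0',\alpha_0'+2\alpha_2\}$. *)

(* Defs.v *)
From mathcomp Require Import all_boot all_order all_algebra.

Set Implicit Arguments.
Unset Strict Implicit.
Unset Printing Implicit Defensive.

Import Order.TTheory GRing.Theory Num.Theory.

(* Connected affine types in Kac's nomenclature: the prefix is the finite     *)
(* letter, the suffix t1/t2/t3 is the superscript (1)/(2)/(3).                *)
Variant affine_type :=
  | At1 of nat        (* A_n^(1),      n >= 1 *)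
  | Bt1 of nat        (* B_n^(1),      n >= 3 *)
  | Ct1 of nat        (* C_n^(1),      n >= 2 *)
  | Dt1 of nat        (* D_n^(1),      n >= 4 *)
  | E6t1
  | E7t1
  | E8t1
  | F4t1
  | G2t1
  | Dt2 of nat        (* D_{n+1}^(2),  n >= 2 *)
  | At2odd of nat     (* A_{2n-1}^(2), n >= 3 *)
  | E6t2
  | D4t3
  | A2t2
  | At2even of nat.   (* A_{2n}^(2),   n >= 2 *)

Definition valid (X : affine_type) : bool :=
  match X with
  | At1 n => 1 <= n
  | Bt1 n => 3 <= n
  | Ct1 n => 2 <= n
  | Dt1 n => 4 <= n
  | Dt2 n => 2 <= n
  | At2odd n => 3 <= n
  | At2even n => 2 <= n
  | E6t1 | E7t1 | E8t1 | F4t1 | G2t1 | E6t2 | D4t3 | A2t2 => true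
  end.

(* The index of the last simple root: the simple roots are numbered from 0    *)
(* to rank X.                                                                 *)
Definition rank (X : affine_type) : nat :=
  match X with
  | At1 n | Bt1 n | Ct1 n | Dt1 n | Dt2 n | At2odd n | At2even n => n
  | E6t1 => 6
  | E7t1 => 7
  | E8t1 => 8
  | F4t1 | E6t2 => 4
  | G2t1 | D4t3 => 2
  | A2t2 => 1
  end.

(* The edges of the path p - p+1 - ... - q. *)
Definition chain (p q : nat) : seq (nat * nat) :=
  [seq (i, i.+1) | i <- index_iota p q].

Definition edges (X : affine_type) : seq (nat * nat) :=
  match X with
  | At1 n => (n, 0) :: chain 0 n
  | Bt1 n | At2odd n => (0, 2) :: chain 1 n
  | Dt1 n => [:: (0, 2), (n - 2, n) & chain 1 n.-1]
  | E6t1 => [:: (3, 6), (6, 0) & chain 1 5]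
  | E7t1 => (3, 7) :: chain 0 6
  | E8t1 => (5, 8) :: chain 0 7
  | Ct1 _ | F4t1 | G2t1 | Dt2 _ | E6t2 | D4t3 | A2t2 | At2even _ =>
      chain 0 (rank X)
  end.

Definition adjacent (X : affine_type) (i j : nat) : bool :=
  ((i, j) \in edges X) || ((j, i) \in edges X).

(* The squared length of the i-th simple root. *)
Definition sqlen (X : affine_type) (i : nat) : nat :=
  match X with
  | At1 _ | Dt1 _ | E6t1 | E7t1 | E8t1 => 2
  | Bt1 n => if i == n then 2 else 4
  | Ct1 n => if (i == 0) || (i == n) then 4 else 2
  | F4t1 => if i <= 2 then 4 else 2
  | G2t1 => if i <= 1 then 6 else 2
  | Dt2 n => if (i == 0) || (i == n) then 2 else 4
  | At2odd n => if i == n then 4 else 2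
  | E6t2 => if i <= 2 then 2 else 4
  | D4t3 => if i <= 1 then 2 else 6
  | A2t2 => if i == 0 then 2 else 8
  | At2even n => if i == 0 then 2 else if i == n then 8 else 4
  end.

Local Open Scope ring_scope.

Definition gram (X : affine_type) (i j : nat) : int :=
  if i == j then (sqlen X i)%:Z
  else if adjacent X i j then
    (if X is At1 1 then - 2%:Z
     else - ((maxn (sqlen X i) (sqlen X j))./2)%:Z)
  else 0.

(* The root lattice, in coordinates with respect to the simple roots. *)
Definition Q (X : affine_type) := 'rV[int]_(rank X).+1.

Definition gram_mx (X : affine_type) : 'M[int]_((rank X).+1) :=
  \matrix_(i, j) gram X i j.

Definition form (X : affine_type) (x y : Q X) : int :=
  (x *m gram_mx X *m y^T) 0 0.

Definition simple_root (X : affine_type) (i : nat) : Q X :=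
  \row_j (val j == i)%:R.

Definition simple_roots (X : affine_type) : seq (Q X) :=
  [seq simple_root X i | i <- iota 0 (rank X).+1].

(* The reflection in a. The division is exact whenever a is a real root, the  *)
(* only case in which it is used.                                             *)
Definition refl (X : affine_type) (a x : Q X) : Q X :=
  x - (divz (2 * form x a) (form a a)) *: a.

(* W(P)P, where W(P) is the group generated by the reflections in elements    *)
(* of P.                                                                      *)
Inductive weyl_orbit (X : affine_type) (P : seq (Q X)) : Q X -> Prop :=
  | weyl_orbit_base a : a \in P -> weyl_orbit P a
  | weyl_orbit_refl a x : a \in P -> weyl_orbit P x -> weyl_orbit P (refl a x).

Definition real_root (X : affine_type) : Q X -> Prop :=
  weyl_orbit (simple_roots X).

(* delta is the element with positive coprime coefficients in the radical of  *)
(* the form, equivalently in the kernel of the Cartan matrix.                 *)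
Definition is_delta (X : affine_type) (d : Q X) : Prop :=
  [/\ gram_mx X *m d^T = 0,
      forall i, 0 < d 0 i
    & \big[gcdn/0%N]_i absz (d 0 i) = 1%N].

Definition isotropic_root (X : affine_type) (x : Q X) : Prop :=
  exists d : Q X, exists k : int, [/\ is_delta d, k != 0 & x = k *: d].

Definition affine_root (X : affine_type) (x : Q X) : Prop :=
  real_root x \/ isotropic_root x.

(* Delta^t. For t = 0 the condition says (x, x) = 0. *)
Definition sub_root (X : affine_type) (t : nat) (x : Q X) : Prop :=
  affine_root x /\ (t%:Z %| form x x)%Z.

Definition trivial_sub (X : affine_type) (t : nat) : Prop :=
  (forall x : Q X, sub_root t x <-> affine_root x) \/
  (forall x : Q X, sub_root t x -> isotropic_root x).

(* Types of root subsystems: a connected one, or a power of A_1^(1). *)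
Variant subtype :=
  | Conn of affine_type
  | A1pow of nat.

Definition subtype_size (T : subtype) : nat :=
  match T with
  | Conn X => (rank X).+1
  | A1pow n => n.*2
  end.

(* For A1pow n, the k-th factor has the simple roots 2k and 2k+1. *)
Definition subtype_gram (T : subtype) (i j : nat) : int :=
  match T with
  | Conn X => gram X i j
  | A1pow _ => if i./2 == j./2 then gram (At1 1) (odd i) (odd j) else 0
  end.

Definition nonneg_comb (X : affine_type) (P : seq (Q X)) (x : Q X) : Prop :=
  exists c : Q X -> nat, x = \sum_(b <- P) b *+ c b.

(* The real roots in S form a root system of type T, up to rescaling of the   *)
(* form, and P is a set of simple roots of it, positive with respect to the   *)
(* simple roots of X.                                                         *)
Record has_type (X : affine_type) (S : Q X -> Prop) (T : subtype)
    (P : seq (Q X)) : Prop := HasType {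
  has_type_uniq : uniq P;
  has_type_root : forall b, b \in P -> S b /\ real_root b;
  has_type_pos : forall b, b \in P -> forall i, 0 <= b 0 i;
  has_type_orbit : forall x, S x /\ real_root x <-> weyl_orbit P x;
  has_type_base : forall x, S x -> real_root x ->
    nonneg_comb P x \/ nonneg_comb P (- x);
  has_type_gram : exists (s : seq (Q X)) (c : rat),
    [/\ perm_eq s P, size s = subtype_size T, 0 < c
      & forall i j, (i < subtype_size T)%N -> (j < subtype_size T)%N ->
          (form s`_i s`_j)%:~R = c * (subtype_gram T i j)%:~R]
}.

Definition minimal (X : affine_type) (S : Q X -> Prop) (P : seq (Q X)) : Prop :=
  forall b, b \in P ->
    exists i : 'I_(rank X).+1,
      [/\ S (simple_root X i), b 0 i = 1
        & forall j : 'I_(rank X).+1, j != i -> S (simple_root X j) -> b 0 j = 0].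

(* D_n^(1) and A_{2n-1}^(2), with D_3^(1) = A_3^(1) and A_3^(2) = D_3^(2). *)
Definition D1_type (n : nat) : affine_type :=
  if n == 3%N then At1 3 else Dt1 n.

Definition A2odd_type (n : nat) : affine_type :=
  if n == 2%N then Dt2 2 else At2odd n.

Section Table.
Variables (V : zmodType) (a : nat -> V) (n : nat).

(* a_n, a_n + 2a_{n-1}, ..., a_n + 2a_{n-1} + ... + 2a_1 *)
Definition upper_family : seq V :=
  [seq a n + (\sum_(j <= i < n) a i) *+ 2 | j <- rev (iota 1 n)].

(* b, b + 2a_1, ..., b + 2a_1 + ... + 2a_{n-1} *)
Definition lower_family (b : V) : seq V :=
  [seq b + (\sum_(1 <= i < j) a i) *+ 2 | j <- iota 1 n].

End Table.

Section Exceptional.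
Variables (X : affine_type) (t : nat).
Local Notation a := (simple_root X).

(* The nontrivial subsystems Delta^t, with their types and simple roots.      *)
(* The general D_{n+1}^(2) row needs n >= 3, as there is no D_2^(1). The      *)
(* diagram D_3^(2) is that of A_3^(2), and its row is the A_{2n-1}^(2) row at *)
(* n = 2, after exchanging the indices 1 and 2.                               *)
Definition exceptional : option (subtype * seq (Q X)) :=
  match X, t with
  | Bt1 n, 4 =>
      Some (Conn (D1_type n),
            [seq a i | i <- iota 0 n] ++ [:: a n.-1 + a n *+ 2])
  | Ct1 n, 4 =>
      Some (A1pow n, upper_family a n ++ lower_family a n (a 0))
  | F4t1, 4 =>
      Some (Conn (Dt1 4),
            [:: a 0; a 1; a 2; a 2 + a 3 *+ 2; a 2 + a 3 *+ 2 + a 4 *+ 2])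
  | G2t1, (3 | 6) =>
      Some (Conn (At1 2), [:: a 0; a 1; a 1 + a 2 *+ 3])
  | Dt2 2, 4 =>
      let a0' := a 0 *+ 2 + a 1 in
      Some (A1pow 2, [:: a 1; a 1 + a 2 *+ 2; a0'; a0' + a 2 *+ 2])
  | Dt2 n, 4 =>
      let a0' := a 0 *+ 2 + a 1 in
      Some (Conn (D1_type n),
            a0' :: [seq a i | i <- iota 1 n.-1] ++ [:: a n.-1 + a n *+ 2])
  | At2odd n, 4 =>
      let a0' := a 0 *+ 2 + (\sum_(2 <= i < n) a i) *+ 2 + a n in
      Some (A1pow n, upper_family a n ++ lower_family a n a0')
  | E6t2, 4 =>
      let a0' := a 0 *+ 2 + a 1 *+ 2 + a 2 *+ 2 + a 3 in
      Some (Conn (Dt1 4),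
            [:: a0'; a 4; a 3; a 3 + a 2 *+ 2; a 3 + a 2 *+ 2 + a 1 *+ 2])
  | D4t3, (3 | 6) =>
      let a0' := a 0 *+ 3 + a 1 *+ 3 + a 2 in
      Some (Conn (At1 2), [:: a0'; a 2; a 2 + a 1 *+ 3])
  | A2t2, (4 | 8) =>
      Some (Conn (At1 1), [:: a 0 *+ 4 + a 1; a 1])
  | At2even n, 4 =>
      let a0' := a 0 *+ 2 + a 1 in
      Some (Conn (A2odd_type n), a0' :: [seq a i | i <- iota 1 n])
  | At2even n, 8 =>
      let a0' := a 0 *+ 2 + a 1 in
      let a0'' := a0' *+ 2 + (\sum_(2 <= i < n) a i) *+ 2 + a n in
      Some (A1pow n, upper_family a n ++ lower_family a n a0'')
  | _, _ => None
  end.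

End Exceptional.

(* Main.v *)
From mathcomp Require Import all_boot all_order all_algebra.
From mathcomp Require Import zify ring.
Require Import Defs.

Set Implicit Arguments.
Unset Strict Implicit.
Unset Printing Implicit Defensive.

Import Order.TTheory GRing.Theory Num.Theory.
Local Open Scope ring_scope.

(** Let J be the set of the simple roots in Delta^t and I the set of the other
    ones. A real root is W-conjugate to a simple root of the same length, so
    the real roots of Delta^t are the W-conjugates of the elements of J. In
    particular Delta^t is trivial exactly when J or I is empty.

    In each exceptional case the proposed base P is the orbit of J under the
    parabolic subgroup W_I: it contains J, it is permuted by the s_i with a_i
    in I, and each of its elements is reached from J by such reflections
    (para_set). Everything except the type follows from this uniformly.
    - A reflection in a_i changes only the coordinate i. Hence an element of P
      has a single nonzero coordinate on J, and it is 1; this is minimality,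
      and positivity follows since the coordinates of a real root have the
      same sign.
    - The set W(P)P contains J and is stable under every simple reflection:
      s_i belongs to W(P) if a_i is in J and permutes P otherwise. So it
      consists of all the real roots of Delta^t (para_set_weyl).
    - A positive real root x of Delta^t is a nonnegative combination of P, by
      induction on the height: if (x, a_i) > 0, then s_i x is lower and still
      positive, unless x = a_i. If a_i is in J, then x is s_i x plus a multiple
      of a_i; otherwise s_i carries an expression of s_i x in P to one of x
      (para_set_pos_comb).

    That real roots are positive or negative (real_root_sign) is read off from
    the form. Write x = p - q with p, q nonnegative of disjoint supports, so
    that (p, p) + (q, q) <= (x, x). As 2x/(x,x) is an integral combination of
    simple coroots, (p, p) and (q, q) are multiples of (x, x). The form is
    positive semidefinite with radical spanned by delta, which has full
    support; hence one of p, q is zero.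

    What remains is to check para_set and the Gram matrix of P in each case.
    Single diagrams are decided by computation in coordinates. When the type
    is a power of A_1^(1), the nodes 1, ..., n form a diagram of type C_n with
    long roots 2 e_j, and P consists of the vectors 2 e_j and c delta - 2 e_j,
    permuted by s_1, ..., s_(n-1) as by transpositions of the e_j. In the
    other series I consists of end nodes of the diagram, and each reflection
    of I exchanges two elements of P and fixes the others. *)

(** * The bilinear form and the Gram matrix *)

Lemma adjacentC (X : affine_type) i j : adjacent X i j = adjacent X j i.
Proof. by rewrite /adjacent orbC. Qed.

Lemma gramC (X : affine_type) i j : gram X i j = gram X j i.
Proof. by rewrite /gram eq_sym adjacentC maxnC; case: eqP => [->|]. Qed.

Lemma gram_diag (X : affine_type) i : gram X i i = (sqlen X i)%:Z.
Proof. by rewrite /gram eqxx. Qed.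

Lemma sqlen_gt0 (X : affine_type) i : (0 < sqlen X i)%N.
Proof. by case: X => //= *; do ?case: ifP. Qed.

Lemma gram_le0 (X : affine_type) i j : i != j -> gram X i j <= 0.
Proof.
rewrite /gram => /negbTE ->; case: ifP => // _.
by case: X => [[|[|n]]|||||||||||||| ] *; rewrite oppr_le0.
Qed.

Lemma gram_lt0 (X : affine_type) i j :
  i != j -> adjacent X i j -> gram X i j < 0.
Proof.
rewrite /gram => /negbTE -> ->.
suff h : (0 < (maxn (sqlen X i) (sqlen X j))./2)%N.
  by case: X h => [[|[|n]]|||||||||||||| ] *; rewrite oppr_lt0.
by rewrite half_gt0 leq_max; case: X => //= *; do ?case: ifP.
Qed.

(** Of two lengths in a diagram one divides the other, which makes the Cartan
    numbers 2 (a_i, a_j) / (a_i, a_i) integers. *)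
Lemma sqlen_dvd_2gram (X : affine_type) i j :
  ((sqlen X i)%:Z %| 2 * gram X i j)%Z.
Proof.
rewrite /gram; case: eqP => [->|_]; first exact: dvdz_mull.
case: ifP => _; last by rewrite mulr0 dvdz0.
have h : (sqlen X i %| 2 * (maxn (sqlen X i) (sqlen X j))./2)%N.
  by case: X => //= *; do ?case: ifP.
by case: X h => [[|[|n]]|||||||||||||| ] *; rewrite mulrN dvdzE abszN.
Qed.

Section Form.
Variable X : affine_type.
Implicit Types x y z a b : Q X.
Local Notation s := (simple_root X).

Lemma formE x y : form x y =
  \sum_(i < (rank X).+1) \sum_(j < (rank X).+1) x 0 i * gram X i j * y 0 j.
Proof.
rewrite /form !mxE exchange_big /=; apply: eq_bigr => j _.
by rewrite !mxE mulr_suml; apply: eq_bigr => i _; rewrite !mxE.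
Qed.

Lemma formC x y : form x y = form y x.
Proof.
rewrite !formE exchange_big; apply: eq_bigr => i _; apply: eq_bigr => j _.
by rewrite gramC; ring.
Qed.

Lemma formDl x y z : form (x + y) z = form x z + form y z.
Proof. by rewrite /form !mulmxDl !mxE. Qed.

Lemma formZl (k : int) x y : form (k *: x) y = k * form x y.
Proof. by rewrite /form -!scalemxAl mxE. Qed.

Lemma formDr x y z : form x (y + z) = form x y + form x z.
Proof. by rewrite formC formDl !(formC x). Qed.

Lemma formZr (k : int) x y : form x (k *: y) = k * form x y.
Proof. by rewrite formC formZl (formC x). Qed.

Lemma formNl x y : form (- x) y = - form x y.
Proof. by rewrite -scaleN1r formZl mulN1r. Qed.

Lemma formNr x y : form x (- y) = - form x y.
Proof. by rewrite formC formNl (formC x). Qed.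

Lemma formBl x y z : form (x - y) z = form x z - form y z.
Proof. by rewrite formDl formNl. Qed.

Lemma formBr x y z : form x (y - z) = form x y - form x z.
Proof. by rewrite formDr formNr. Qed.

Lemma formMnl x y n : form (x *+ n) y = form x y *+ n.
Proof. by rewrite -scaler_nat formZl mulr_natl. Qed.

Lemma formMnr x y n : form x (y *+ n) = form x y *+ n.
Proof. by rewrite formC formMnl (formC x). Qed.

Lemma form0l y : form 0 y = 0.
Proof. by rewrite -(scale0r 0) formZl mul0r. Qed.

Lemma form_suml (I : Type) (r : seq I) (P : pred I) (F : I -> Q X) y :
  form (\sum_(i <- r | P i) F i) y = \sum_(i <- r | P i) form (F i) y.
Proof.
by elim/big_rec2: _ => [|i v u _ <-]; rewrite ?form0l ?formDl.
Qed.

Lemma form_sumr (I : Type) (r : seq I) (P : pred I) (F : I -> Q X) x :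
  form x (\sum_(i <- r | P i) F i) = \sum_(i <- r | P i) form x (F i).
Proof. by rewrite formC form_suml; apply: eq_bigr => i _; apply: formC. Qed.

Definition formE_lin :=
  (formDl, formDr, formBl, formBr, formNl, formNr, formMnl, formMnr,
   formZl, formZr).

Lemma simple_rootE i (k : 'I_(rank X).+1) : s i 0 k = (val k == i)%:R.
Proof. by rewrite mxE. Qed.

Lemma simple_root_sum x : x = \sum_(i < (rank X).+1) x 0 i *: s i.
Proof.
apply/rowP => k; rewrite summxE (bigD1 k) //= mxE simple_rootE eqxx mulr1.
rewrite big1 ?addr0 // => i ik; rewrite mxE simple_rootE.
by case: eqP => [/val_inj/esym/eqP|]; rewrite ?mulr0 ?(negbTE ik).
Qed.

Lemma form_simple i j : (i <= rank X)%N -> (j <= rank X)%N ->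
  form (s i) (s j) = gram X i j.
Proof.
rewrite -ltnS => hi; rewrite -ltnS => hj; rewrite formE.
rewrite (bigD1 (Ordinal hi)) //= [X in _ + X]big1 ?addr0 => [|k kj].
  rewrite (bigD1 (Ordinal hj)) //= [X in _ + X]big1 ?addr0 => [|k kj].
    by rewrite !simple_rootE !eqxx mul1r mulr1.
  rewrite [s j _ _]simple_rootE; case: eqP => [e|]; rewrite ?mulr0 //.
  by case/eqP: kj; apply: val_inj.
rewrite big1 // => l _; rewrite [s i _ _]simple_rootE.
case: eqP => [e|]; rewrite ?mul0r //.
by case/eqP: kj; apply: val_inj.
Qed.

Lemma form_simpler x j : (j <= rank X)%N ->
  form x (s j) = \sum_(i < (rank X).+1) x 0 i * gram X i j.
Proof.
move=> hj; rewrite {1}[x]simple_root_sum form_suml.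
by apply: eq_bigr => i _; rewrite formZl form_simple // -ltnS.
Qed.

(** * Reflections *)

(** A vector with an integral coroot: its reflection preserves the root
    lattice and the division in the definition of a reflection is exact. *)
Definition integral a : Prop :=
  0 < form a a /\ forall x, (form a a %| 2 * form x a)%Z.

Lemma refl_exact a x (k : int) :
  form a a != 0 -> 2 * form x a = k * form a a -> refl a x = x - k *: a.
Proof. by move=> h e; rewrite /refl e mulzK. Qed.

Lemma integral_neq0 a : integral a -> form a a != 0.
Proof. by case=> h _; rewrite gt_eqF. Qed.

Lemma integralP a x : integral a ->
  exists2 k : int, 2 * form x a = k * form a a & refl a x = x - k *: a.
Proof.
move=> ha; have /dvdzP[k e] := ha.2 x; exists k => //.
exact: refl_exact (integral_neq0 ha) e.
Qed.

Lemma refl_fixed a x : form x a = 0 -> refl a x = x.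
Proof. by move=> h; rewrite /refl h mulr0 div0z scale0r subr0. Qed.

Lemma refl_self a : integral a -> refl a a = - a.
Proof.
move=> /integral_neq0 h; rewrite (refl_exact (k := 2) h) //.
by rewrite scaler_nat mulr2n opprD addNKr.
Qed.

Lemma reflD a x y : integral a -> refl a (x + y) = refl a x + refl a y.
Proof.
move=> ha; have [k ek ->] := integralP x ha; have [l el ->] := integralP y ha.
rewrite (refl_exact (k := k + l) (integral_neq0 ha)).
  by rewrite scalerDl opprD addrACA.
by rewrite formDl mulrDr ek el mulrDl.
Qed.

Lemma reflZ a (c : int) x : integral a -> refl a (c *: x) = c *: refl a x.
Proof.
move=> ha; have [k ek ->] := integralP x ha.
rewrite (refl_exact (k := c * k) (integral_neq0 ha)).
  by rewrite scalerBr scalerA.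
by rewrite formZl mulrCA ek mulrA.
Qed.

Lemma reflN a x : integral a -> refl a (- x) = - refl a x.
Proof. by move=> ha; rewrite -scaleN1r reflZ // scaleN1r. Qed.

Lemma reflK a : integral a -> involutive (refl a).
Proof.
move=> ha x; have [k ek ->] := integralP x ha.
rewrite (refl_exact (k := - k) (integral_neq0 ha)).
  by rewrite scaleNr opprK subrK.
by rewrite formBl formZl mulrBr ek; ring.
Qed.

Lemma form_refl a x y : integral a -> form (refl a x) (refl a y) = form x y.
Proof.
move=> ha; have [k ek ->] := integralP x ha; have [l el ->] := integralP y ha.
rewrite !formE_lin (formC a y).
have := congr1 ( *%R l) ek; have := congr1 ( *%R k) el => e1 e2; lia.
Qed.

Lemma form_reflC a x y : integral a -> form (refl a x) y = form x (refl a y).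
Proof. by move=> ha; rewrite -(form_refl (a := a)) // reflK. Qed.

Lemma integral_refl a b : integral a -> integral b -> integral (refl a b).
Proof.
move=> ha [h0 hb]; split=> [|x]; rewrite form_refl // -form_reflC //.
Qed.

Lemma refl_conj a b x : integral a -> integral b ->
  refl a (refl b x) = refl (refl a b) (refl a x).
Proof.
move=> ha hb; have [k ek ->] := integralP x hb.
rewrite reflD // reflN // reflZ //; apply/esym/refl_exact.
  by rewrite form_refl // integral_neq0.
by rewrite !form_refl.
Qed.

Lemma integral_simple i : (i <= rank X)%N -> integral (s i).
Proof.
move=> hi; split=> [|x].
  by rewrite form_simple // gram_diag ltz_nat sqlen_gt0.
rewrite form_simpler // form_simple // gram_diag mulr_sumr.
apply: rpred_sum => j _.
by rewrite mulrCA gramC dvdz_mull // sqlen_dvd_2gram.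
Qed.

End Form.

Arguments integral {X} a.

(** * Weyl orbits and real roots *)

Section WeylOrbit.
Variable X : affine_type.
Implicit Types (x y a b : Q X) (P : seq (Q X)).

Lemma weyl_orbit_integral P x :
  {in P, forall b, integral b} -> weyl_orbit P x -> integral x.
Proof.
by move=> hP; elim=> [a /hP|a y aP _ hy] //; apply: integral_refl => //; apply: hP.
Qed.

(** W(P)P is closed under the reflections in all of its elements, because the
    reflection in s_b a is s_b s_a s_b. *)
Lemma weyl_orbit_reflW P a x : {in P, forall b, integral b} ->
  weyl_orbit P a -> weyl_orbit P x -> weyl_orbit P (refl a x).
Proof.
move=> hP ha; elim: ha x => {a} [a aP|b a bP ha IH] x hx.
  exact: weyl_orbit_refl.
have hb := hP b bP; have h := weyl_orbit_integral hP ha.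
rewrite -[x](reflK hb) -refl_conj //.
by apply: weyl_orbit_refl => //; apply/IH/weyl_orbit_refl.
Qed.

(** As s_c s_a = s_(s_c a) s_c, only the images of the generators under s_c
    have to be controlled. *)
Lemma weyl_orbit_stable P c : {in P, forall b, integral b} -> integral c ->
  {in P, forall b, weyl_orbit P (refl c b)} ->
  forall x, weyl_orbit P x -> weyl_orbit P (refl c x).
Proof.
move=> hP hc hst x; elim=> [a /hst|a y aP hy IH] //.
rewrite refl_conj //; last exact: hP.
by apply: weyl_orbit_reflW => //; apply: hst.
Qed.

End WeylOrbit.

Section RealRoots.
Variable X : affine_type.
Implicit Types (x y a b : Q X).
Local Notation s := (simple_root X).

Lemma mem_simple_roots b :
  b \in simple_roots X -> exists2 i, (i <= rank X)%N & b = s i.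
Proof. by case/mapP => i; rewrite mem_iota => h ->; exists i. Qed.

Lemma simple_rootsP i : (i <= rank X)%N -> s i \in simple_roots X.
Proof. by move=> h; apply/mapP; exists i => //; rewrite mem_iota. Qed.

Lemma integral_simple_roots : {in simple_roots X, forall b, integral b}.
Proof. by move=> b /mem_simple_roots[i hi ->]; apply: integral_simple. Qed.

Lemma real_simple i : (i <= rank X)%N -> real_root (s i).
Proof. by move=> h; apply/weyl_orbit_base/simple_rootsP. Qed.

Lemma real_integral x : real_root x -> integral x.
Proof. exact/weyl_orbit_integral/integral_simple_roots. Qed.

Lemma real_refl a x : real_root a -> real_root x -> real_root (refl a x).
Proof. exact/weyl_orbit_reflW/integral_simple_roots. Qed.

Lemma real_ind (T : Q X -> Prop) :
  (forall i, (i <= rank X)%N -> T (s i)) ->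
  (forall i x, (i <= rank X)%N -> real_root x -> T x -> T (refl (s i) x)) ->
  forall x, real_root x -> T x.
Proof.
move=> h0 hS x; elim=> [b|b y] /mem_simple_roots[i hi ->]; first exact: h0.
exact: hS.
Qed.

Lemma real_length x : real_root x ->
  exists2 i, (i <= rank X)%N & form x x = (sqlen X i)%:Z.
Proof.
move: x; apply: real_ind => [i hi|i x hi hx [j hj e]].
  by exists i; rewrite ?form_simple ?gram_diag.
by exists j; rewrite ?form_refl //; apply: integral_simple.
Qed.

(** Excludes proper multiples of a simple root in the descent on the height. *)
Lemma real_primitive x : real_root x ->
  forall (k : int) y, x = k *: y -> `|k| = 1.
Proof.
move: x; apply: real_ind => [i hi|i x hi hx IH] k y e.
  have := congr1 (fun z : Q X => z 0 (inord i)) e.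
  rewrite !mxE /= inordK // eqxx => h.
  by have := dvdz_mulr (y 0 (inord i)) (dvdzz k); rewrite -h dvdz1; lia.
apply: (IH k (refl (s i) y)).
by rewrite -reflZ -?e ?reflK //; apply: integral_simple.
Qed.

(** The coefficients of the coroot 2x/(x,x) on the simple coroots are the
    x_i (a_i, a_i) / (x, x); integrality of the coroot gives divisibility. *)
Lemma real_coroot x : real_root x ->
  forall i : 'I_(rank X).+1, (form x x %| (x 0%R i : int) * (sqlen X i)%:Z)%Z.
Proof.
move: x; apply: real_ind => [j hj|j x hj hx IH] i.
  rewrite form_simple // gram_diag mxE.
  by case: eqP => [->|_]; rewrite ?mul1r ?mul0r ?dvdz0.
have hs := integral_simple hj.
rewrite form_refl //; have [k ek ->] := integralP x hs.
rewrite !mxE mulrBl rpredB //=; case: eqP => [->|_]; last first.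
  by rewrite mulr0 mul0r dvdz0.
rewrite mulr1 -gram_diag -(form_simple hj hj) -ek form_simpler // mulr_sumr.
apply: rpred_sum => l _.
have /dvdzP[c ec] := sqlen_dvd_2gram X l j.
by rewrite mulrCA ec mulrCA dvdz_mull.
Qed.

End RealRoots.

(** * Marks and positive semidefiniteness *)

(** The coordinates of delta, i.e. Kac's labels of the affine diagram. *)
Definition mark (X : affine_type) (i : nat) : nat :=
  match X with
  | At1 _ | Dt2 _ => 1
  | Bt1 _ => if (i <= 1)%N then 1 else 2
  | Ct1 n => if (i == 0) || (i == n) then 1 else 2
  | Dt1 n => if (i <= 1)%N || (n.-1 <= i)%N then 1 else 2
  | E6t1 => nth 1 [:: 1; 1; 2; 3; 2; 1; 2] i
  | E7t1 => nth 1 [:: 1; 2; 3; 4; 3; 2; 1; 2] i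
  | E8t1 => nth 1 [:: 1; 2; 3; 4; 5; 6; 4; 2; 3] i
  | F4t1 => nth 1 [:: 1; 2; 3; 4; 2] i
  | G2t1 => nth 1 [:: 1; 2; 3] i
  | At2odd n => if (i <= 1)%N || (i == n) then 1 else 2
  | E6t2 => nth 1 [:: 1; 2; 3; 2; 1] i
  | D4t3 => nth 1 [:: 1; 2; 1] i
  | A2t2 => if i == 0 then 2 else 1
  | At2even n => if i == n then 1 else 2
  end%N.

Lemma mark_gt0 (X : affine_type) i : (0 < mark X i)%N.
Proof.
case: X => * /=; do ?case: ifP => // _.
all: by do 9?[case: i => [|i] //=]; rewrite nth_nil.
Qed.

Lemma mem_chain p q i j :
  ((i, j) \in chain p q) = [&& (p <= i)%N, (i < q)%N & j == i.+1].
Proof.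
apply/mapP/and3P => [[k]|[h1 h2 /eqP ->]]; first rewrite mem_index_iota.
  by case/andP=> h1 h2 [-> ->].
by exists i; rewrite ?mem_index_iota ?h1.
Qed.

Lemma gram_adjacent (X : affine_type) i j : X <> At1 1 -> i != j ->
  adjacent X i j -> gram X i j = - ((maxn (sqlen X i) (sqlen X j))./2)%:Z.
Proof. by rewrite /gram => hX /negbTE -> ->; case: X hX => [[|[|n]]|||||||||||||| ]. Qed.

Lemma gram_nonadjacent (X : affine_type) i j : i != j ->
  ~~ adjacent X i j -> gram X i j = 0.
Proof. by rewrite /gram => /negbTE -> /negbTE ->. Qed.

Lemma sum_supp m (f : nat -> int) (r : seq nat) :
  uniq r -> all (fun k => k < m)%N r ->
  (forall j, (j < m)%N -> j \notin r -> f j = 0) ->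
  \sum_(j < m) f j = \sum_(j <- r) f j.
Proof.
move=> ur /allP hr h0; rewrite -(big_mkord predT) /index_iota subn0.
rewrite (bigID (mem r)) /= [X in _ + X]big1_seq ?addr0 => [|j].
  rewrite -big_filter; apply: perm_big; apply: uniq_perm => //.
    exact/filter_uniq/iota_uniq.
  by move=> j; rewrite mem_filter mem_iota; case: (boolP (j \in r)) => // /hr.
by case/andP=> jr; rewrite mem_iota => /h0; apply.
Qed.

(** A row of the Gram matrix is supported on the node and its neighbours. *)
Lemma marks_row (X : affine_type) i (r : seq nat) :
  uniq r -> all (fun k => k < (rank X).+1)%N r ->
  (forall j, (j < (rank X).+1)%N -> j \notin r ->
     i != j /\ ~~ adjacent X i j) ->
  \sum_(j < (rank X).+1) gram X i j * (mark X j)%:Z =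
  \sum_(j <- r) gram X i j * (mark X j)%:Z.
Proof.
move=> ur hr h; pose f j := gram X i j * (mark X j)%:Z.
apply: (sum_supp (f := f)) => // j hj /(h j hj)[h1 h2].
by rewrite /f gram_nonadjacent ?mul0r.
Qed.

(** Decides adjacency in a diagram of a series. *)
Ltac edge_lia := rewrite /adjacent /edges /= ?inE ?mem_chain ?xpair_eqE; lia.

Ltac row r :=
  rewrite (marks_row (r := r));
  [ rewrite ?big_cons big_nil
  | by rewrite /= ?inE; lia
  | by rewrite /=; lia
  | let j := fresh "j" in move=> /= j; rewrite ?inE => ? ?;
    split; [lia | edge_lia] ].

Ltac gram_val :=
  rewrite ?gram_diag;
  repeat (rewrite gram_adjacent; [ | by [] | by lia | edge_lia]);
  rewrite /sqlen /mark /=; repeat (case: ifP => ?); lia.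

Definition marks_kernel (X : affine_type) : Prop :=
  forall i, (i <= rank X)%N ->
    \sum_(j < (rank X).+1) gram X i j * (mark X j)%:Z = 0.

Lemma marks_kernel_At1 n : (2 <= n)%N -> marks_kernel (At1 n).
Proof.
move=> hn i hi; have {}hi : (i <= n)%N := hi.
have h1 : At1 n <> At1 1 by move=> [e]; rewrite e in hn.
have [i0|[i_n|hi']] : i = 0%N \/ i = n \/ (0 < i < n)%N by lia.
- subst i; row [:: 0; 1; n]%N. gram_val.
- subst i; row [:: n.-1; n; 0]%N. gram_val.
row [:: i.-1; i; i.+1]%N. gram_val.
Qed.

Lemma marks_kernel_Bt1 n : (3 <= n)%N -> marks_kernel (Bt1 n).
Proof.
move=> hn i hi; have {}hi : (i <= n)%N := hi.
have [i0|[i1|[i2|[i_n|hi']]]] :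
    i = 0%N \/ i = 1%N \/ i = 2%N \/ i = n \/ (2 < i < n)%N by lia.
- subst i; row [:: 0; 2]%N. gram_val.
- subst i; row [:: 1; 2]%N. gram_val.
- subst i; row [:: 0; 1; 2; 3]%N. gram_val.
- subst i; row [:: n.-1; n]%N. gram_val.
row [:: i.-1; i; i.+1]%N. gram_val.
Qed.

Lemma marks_kernel_At2odd n : (3 <= n)%N -> marks_kernel (At2odd n).
Proof.
move=> hn i hi; have {}hi : (i <= n)%N := hi.
have [i0|[i1|[i2|[i_n|hi']]]] :
    i = 0%N \/ i = 1%N \/ i = 2%N \/ i = n \/ (2 < i < n)%N by lia.
- subst i; row [:: 0; 2]%N. gram_val.
- subst i; row [:: 1; 2]%N. gram_val.
- subst i; row [:: 0; 1; 2; 3]%N. gram_val.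
- subst i; row [:: n.-1; n]%N. gram_val.
row [:: i.-1; i; i.+1]%N. gram_val.
Qed.

Lemma marks_kernel_Ct1 n : (2 <= n)%N -> marks_kernel (Ct1 n).
Proof.
move=> hn i hi; have {}hi : (i <= n)%N := hi.
have [i0|[i_n|hi']] : i = 0%N \/ i = n \/ (0 < i < n)%N by lia.
- subst i; row [:: 0; 1]%N. gram_val.
- subst i; row [:: n.-1; n]%N. gram_val.
row [:: i.-1; i; i.+1]%N. gram_val.
Qed.

Lemma marks_kernel_Dt2 n : (2 <= n)%N -> marks_kernel (Dt2 n).
Proof.
move=> hn i hi; have {}hi : (i <= n)%N := hi.
have [i0|[i_n|hi']] : i = 0%N \/ i = n \/ (0 < i < n)%N by lia.
- subst i; row [:: 0; 1]%N. gram_val.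
- subst i; row [:: n.-1; n]%N. gram_val.
row [:: i.-1; i; i.+1]%N. gram_val.
Qed.

Lemma marks_kernel_At2even n : (2 <= n)%N -> marks_kernel (At2even n).
Proof.
move=> hn i hi; have {}hi : (i <= n)%N := hi.
have [i0|[i_n|hi']] : i = 0%N \/ i = n \/ (0 < i < n)%N by lia.
- subst i; row [:: 0; 1]%N. gram_val.
- subst i; row [:: n.-1; n]%N. gram_val.
row [:: i.-1; i; i.+1]%N. gram_val.
Qed.

Lemma marks_kernel_Dt1 n : (5 <= n)%N -> marks_kernel (Dt1 n).
Proof.
move=> hn i hi; have {}hi : (i <= n)%N := hi.
have [i0|[i1|[i2|[i3|[i4|[i5|hi']]]]]] :
    i = 0%N \/ i = 1%N \/ i = 2%N \/ i = (n - 2)%N \/ i = n.-1 \/ i = n \/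
    (2 < i < n - 2)%N by lia.
- subst i; row [:: 0; 2]%N. gram_val.
- subst i; row [:: 1; 2]%N. gram_val.
- subst i; row [:: 0; 1; 2; 3]%N. gram_val.
- subst i; row [:: (n - 3)%N; (n - 2)%N; n.-1; n]%N. gram_val.
- subst i; row [:: (n - 2)%N; n.-1]%N. gram_val.
- subst i; row [:: (n - 2)%N; n]%N. gram_val.
row [:: i.-1; i; i.+1]%N. gram_val.
Qed.

Lemma sum_foldr n (f : nat -> int) :
  \sum_(j < n) f j = foldr (fun j c => f j + c) 0 (iota 0 n).
Proof.
rewrite -(big_mkord predT f) /index_iota subn0.
by elim: (iota _ _) => [|j r IH]; rewrite ?big_nil ?big_cons //= IH.
Qed.

Lemma marks_kernel_check (X : affine_type) :
  all (fun i => foldr (fun j c => gram X i j * (mark X j)%:Z + c) 0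
                  (iota 0 (rank X).+1) == 0) (iota 0 (rank X).+1) ->
  marks_kernel X.
Proof.
move/allP => h i hi; have := h i; rewrite mem_iota add0n ltnS hi => /(_ isT)/eqP e.
rewrite -[RHS]e; exact: (sum_foldr _ (fun j => gram X i j * (mark X j)%:Z)).
Qed.

Lemma marks_kernelP (X : affine_type) : valid X -> marks_kernel X.
Proof.
case: X => [[|[|n]]|n|n|[|[|[|[|[|n]]]]]||||||n|n||||n] // hX.
all: try by apply: marks_kernel_check; vm_compute.
- exact: marks_kernel_At1.
- exact: marks_kernel_Bt1.
- exact: marks_kernel_Ct1.
- exact: marks_kernel_Dt1.
- exact: marks_kernel_Dt2.
- exact: marks_kernel_At2odd.
- exact: marks_kernel_At2even.
Qed.

Lemma chain_constant (T : Type) (f : nat -> T) p q :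
  (forall i, (p <= i < q)%N -> f i = f i.+1) ->
  forall i, (p <= i <= q)%N -> f i = f p.
Proof.
move=> h; elim=> [|i IH] hi; first by congr f; lia.
have [<-//|hp] := eqVneq p i.+1.
by rewrite -h; [apply: IH|]; lia.
Qed.

Lemma diagram_connected (X : affine_type) (T : Type) (f : nat -> T) : valid X ->
  (forall i j, adjacent X i j -> f i = f j) ->
  forall i, (i <= rank X)%N -> f i = f 1%N.
Proof.
move=> hX h.
have edge p q : (p, q) \in edges X -> f p = f q.
  by move=> e; apply: h; rewrite /adjacent e.
have along p q : {subset chain p q <= edges X} ->
    forall i, (p <= i <= q)%N -> f i = f p.
  move=> hs; apply: chain_constant => i /andP[h1 h2].
  by apply/edge/hs; rewrite mem_chain h1 h2 eqxx.
have from0 q : {subset chain 0 q <= edges X} -> (1 <= q)%N ->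
    forall i, (i <= q)%N -> f i = f 1%N.
  by move=> hs hq i hi; rewrite (along _ _ hs) ?(along _ _ hs 1%N).
have from1 q : {subset chain 1 q <= edges X} ->
    forall i, (0 < i <= q)%N -> f i = f 1%N.
  by move=> hs i hi; apply: (along _ _ hs).
clear h along; case: X hX edge from0 from1 =>
  [n|n|n|n||||||n|n||||n] //= hX edge from0 from1 i hi.
all: try by apply: (from0 _ _ _ _ hi); [move=> e; rewrite ?inE => ->; rewrite ?orbT | lia].
- have [->|i0] := posnP i; last first.
    by apply: (from1 n) => [e he|]; rewrite ?inE ?he ?orbT ?i0.
  rewrite (edge 0%N 2%N) ?inE //; apply: (from1 n) => [e he|]; last by lia.
  by rewrite inE he orbT.
- have [->|i0] := posnP i.
    rewrite (edge 0%N 2%N) ?inE //; apply: (from1 n.-1) => [e he|]; last by lia.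
    by rewrite !inE he !orbT.
  have [->|i_n] := eqVneq i n.
    rewrite -(edge (n - 2)%N n) ?inE ?eqxx ?orbT //.
    by apply: (from1 n.-1) => [e he|]; [rewrite !inE he !orbT | lia].
  by apply: (from1 n.-1) => [e he|]; [rewrite !inE he !orbT | lia].
- have h6 : f 6%N = f 1%N.
    by rewrite -(edge 3%N) ?inE //; apply: (from1 5%N); first apply/allP.
  have [->|i0] := posnP i; first by rewrite -(edge 6%N).
  have [->//|i6] := eqVneq i 6%N.
  by apply: (from1 5%N); [apply/allP | lia].
- have [->|i7] := eqVneq i 7%N; first rewrite -(edge 3%N) ?inE //.
    by apply: (from0 6%N) => //; apply/allP.
  by apply: (from0 6%N); [apply/allP | | lia].
- have [->|i8] := eqVneq i 8%N; first rewrite -(edge 5%N) ?inE //.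
    by apply: (from0 7%N) => //; apply/allP.
  by apply: (from0 7%N); [apply/allP | | lia].
have [->|i0] := posnP i; last first.
  by apply: (from1 n) => [e he|]; rewrite ?inE ?he ?orbT ?i0.
rewrite (edge 0%N 2%N) ?inE //; apply: (from1 n) => [e he|]; last by lia.
by rewrite inE he orbT.
Qed.

Lemma adjacent_bound (X : affine_type) p q : valid X -> adjacent X p q ->
  (p <= rank X)%N /\ (q <= rank X)%N.
Proof.
move=> hX; suff h u v : (u, v) \in edges X -> (u <= rank X)%N /\ (v <= rank X)%N.
  by case/orP => /h [].
case: X hX => [n|n|n|n||||||n|n||||n] /=; rewrite ?inE ?mem_chain ?xpair_eqE; lia.
Qed.

Section Psd.
Variable X : affine_type.
Hypothesis hX : valid X.
Implicit Types x y : Q X.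
Local Notation s := (simple_root X).
Local Notation m i := (mark X i).

(** The form as a sum of squares of differences of coordinates x_i / m_i,
    with nonnegative weights supported on the edges of the diagram. The
    diagonal terms cancel because the marks m are in the kernel of the Gram
    matrix. *)
Lemma form_sum_squares x (y : 'I_(rank X).+1 -> rat) :
  (forall i, (x 0 i)%:~R = (m i)%:R * y i) ->
  (form x x)%:~R *+ 2 = \sum_(i < (rank X).+1) \sum_(j < (rank X).+1)
     (- gram X i j)%:~R * (m i * m j)%:R * (y i - y j) ^+ 2 :> rat.
Proof.
move=> hy; pose G (i j : 'I_(rank X).+1) : rat :=
  (gram X i j)%:~R * (m i)%:R * (m j)%:R.
have GC i j : G i j = G j i by rewrite /G gramC; ring.
have G0 i : \sum_j G i j = 0.
  transitivity ((m i)%:R * (\sum_(j < (rank X).+1) gram X i j * (m j)%:Z)%:~R : rat).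
    rewrite rmorph_sum mulr_sumr; apply: eq_bigr => j _.
    by rewrite /G rmorphM /= -pmulrn; ring.
  by rewrite (marks_kernelP hX) ?mulr0 // -ltnS.
have e1 : \sum_i \sum_j G i j * y i ^+ 2 = 0.
  by apply: big1 => i _; rewrite -mulr_suml G0 mul0r.
have e2 : \sum_i \sum_j G i j * y j ^+ 2 = 0.
  rewrite exchange_big; apply: big1 => j _; rewrite -mulr_suml.
  by under eq_bigr => i _ do rewrite GC; rewrite G0 mul0r.
have e3 : (form x x)%:~R = \sum_i \sum_j G i j * y i * y j.
  rewrite formE rmorph_sum; apply: eq_bigr => i _; rewrite rmorph_sum.
  by apply: eq_bigr => j _; rewrite !rmorphM /= !hy /G; ring.
transitivity ((\sum_i \sum_j G i j * y i * y j) *+ 2 -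
    (\sum_i \sum_j G i j * y i ^+ 2 + \sum_i \sum_j G i j * y j ^+ 2)).
  by rewrite e3 e1 e2 [0 + 0]addr0 subr0.
rewrite -big_split -sumrMnl -sumrB; apply: eq_bigr => i _ /=.
rewrite -big_split -sumrMnl -sumrB; apply: eq_bigr => j _ /=.
by rewrite /G rmorphN natrM; ring.
Qed.

Definition normalized x (i : 'I_(rank X).+1) : rat := (x 0 i)%:~R / (m i)%:R.

Lemma normalizedK x i : (x 0 i)%:~R = (m i)%:R * normalized x i.
Proof. by rewrite mulrCA divff ?mulr1 // pnatr_eq0 -lt0n mark_gt0. Qed.

Lemma form_term_ge0 x (i j : 'I_(rank X).+1) :
  0 <= (- gram X i j)%:~R * (m i * m j)%:R *
  (normalized x i - normalized x j) ^+ 2.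
Proof.
have [->|ij] := eqVneq i j; first by rewrite subrr expr0n mulr0.
apply/mulr_ge0/sqr_ge0/mulr_ge0; last exact: ler0n.
by rewrite ler0z oppr_ge0 gram_le0.
Qed.

Lemma form_ge0 x : 0 <= form x x.
Proof.
rewrite -(ler0z rat) -(pmulrn_lge0 _ (ltn0Sn 1)).
rewrite (form_sum_squares (normalizedK x)).
by do 2!apply: sumr_ge0 => ? _; apply: form_term_ge0.
Qed.

(** All the squares in form_sum_squares vanish, so x_i / m_i is constant along
    the edges of the diagram, which is connected. *)
Lemma form_null x : form x x = 0 ->
  forall i j : 'I_(rank X).+1, x 0 i * (m j)%:Z = x 0 j * (m i)%:Z.
Proof.
move=> h0; have := form_sum_squares (normalizedK x); rewrite h0 mul0rn => /esym/eqP.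
rewrite psumr_eq0 => [/allP h1|i _]; last first.
  by apply: sumr_ge0 => j _; apply: form_term_ge0.
have h2 (i j : 'I_(rank X).+1) :
    adjacent X i j -> normalized x i = normalized x j.
  have [->//|ij] := eqVneq i j => adj.
  have := h1 i; rewrite mem_index_enum => /(_ isT).
  rewrite /= psumr_eq0 => [/allP/(_ j)|k _]; last exact: form_term_ge0.
  rewrite mem_index_enum => /(_ isT) /=.
  rewrite mulf_eq0 sqrf_eq0 mulf_eq0 intr_eq0 oppr_eq0 lt_eqF ?gram_lt0 //=.
  by rewrite pnatr_eq0 muln_eq0 !gtn_eqF ?mark_gt0 //= subr_eq0 => /eqP.
have h3 i : (i <= rank X)%N -> normalized x (inord i) = normalized x (inord 1).
  apply: (diagram_connected (f := fun k => normalized x (inord k)) hX) => p q h.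
  have [hp hq] := adjacent_bound hX h.
  by apply: h2; rewrite !inordK.
move=> i j.
have e : normalized x i = normalized x j.
  by rewrite -[i]inord_val -[j]inord_val !h3 // -ltnS.
apply/eqP; rewrite -(eqr_int rat) !rmorphM /= !normalizedK e -!pmulrn.
by apply/eqP; ring.
Qed.

End Psd.

(** * Real roots have coordinates of one sign *)

Section Sign.
Variable X : affine_type.
Hypothesis hX : valid X.
Implicit Types x : Q X.

Lemma form_null_support x : form x x = 0 -> (forall i, 0 <= x 0 i) ->
  (forall i, x 0 i = 0) \/ (forall i, 0 < x 0 i).
Proof.
move=> h0 hx; case: (boolP [exists i, x 0 i != 0]) => [/existsP[i xi]|]; last first.
  by rewrite negb_exists => /forallP h; left=> i; apply/eqP; rewrite -[_ == _]negbK.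
right=> j; rewrite lt_def hx andbT; apply/eqP => xj.
have /eqP := form_null hX h0 i j; rewrite xj mul0r mulf_eq0 (negbTE xi) /=.
by have := mark_gt0 X j; lia.
Qed.

(** The hypothesis says that 2x/c is an integral combination of the simple
    coroots. The square terms of (x, x) are multiples of x_i (a_i, a_i), and so
    are the cross terms 2 x_i x_j (a_i, a_j), by integrality of the Cartan
    numbers. *)
Lemma dvd_form (c : int) x :
  (forall i : 'I_(rank X).+1, c %| (x 0%R i : int) * (sqlen X i)%:Z)%Z ->
  (c %| form x x)%Z.
Proof.
move=> hx; pose K (u : Q X) := (c %| form u u)%Z /\ forall w, (c %| 2 * form u w)%Z.
suff [] : K x by [].
rewrite [x]simple_root_sum; apply: (big_ind K).
- by split=> [|w]; rewrite form0l ?mulr0 dvdz0.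
- move=> u v [u1 u2] [v1 v2]; split=> [|w]; last by rewrite formDl mulrDr rpredD.
  have -> : form (u + v) (u + v) = form u u + 2 * form u v + form v v.
    by rewrite !formE_lin (formC v u); ring.
  by rewrite !rpredD.
move=> i _; have hi : (i <= rank X)%N by rewrite -ltnS.
split=> [|w]; rewrite formZl.
  rewrite formZr form_simple // gram_diag mulrCA; exact: dvdz_mull.
rewrite formC form_simpler // !mulr_sumr; apply: rpred_sum => j _.
have /dvdzP[k ek] := sqlen_dvd_2gram X i j.
have -> : 2 * (x 0 i * (w 0 j * gram X j i)) =
    w 0 j * k * (x 0 i * (sqlen X i)%:Z).
  by rewrite gramC; transitivity (x 0 i * w 0 j * (2 * gram X i j));
     [ring | rewrite ek; ring].
exact: dvdz_mull.
Qed.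

(** Write a real root x as p - q with p, q nonnegative of disjoint supports.
    Then (p, p) + (q, q) <= (x, x), both summands are nonnegative multiples of
    (x, x), so one of them vanishes, and an isotropic p has empty or full
    support. *)
Lemma real_root_sign x : real_root x ->
  (forall i, 0 <= x 0 i) \/ (forall i, x 0 i <= 0).
Proof.
move=> rx; have [x0 _] := real_integral rx; have hd := real_coroot rx.
pose p : Q X := \row_i Num.max (x 0 i) 0.
pose q : Q X := \row_i Num.max (- x 0 i) 0.
have xE : x = p - q by apply/rowP => i; rewrite !mxE; lia.
have p0 i : 0 <= p 0 i by rewrite mxE; lia.
have q0 i : 0 <= q 0 i by rewrite mxE; lia.
have pq : form p q <= 0.
  rewrite formE; apply: sumr_le0 => i _; apply: sumr_le0 => j _.
  have [<-|ij] := eqVneq i j.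
    have : p 0 i = 0 \/ q 0 i = 0 by rewrite !mxE; lia.
    by case=> ->; rewrite ?mul0r ?mulr0.
  by rewrite mulr_le0_ge0 ?mulr_ge0_le0 // gram_le0.
have hp : (form x x %| form p p)%Z.
  apply: dvd_form => i; rewrite mxE.
  by case: (leP (x 0 i) 0) => _; rewrite ?mul0r ?dvdz0.
have hq : (form x x %| form q q)%Z.
  apply: dvd_form => i; rewrite mxE.
  by case: (leP (- x 0 i) 0) => _; rewrite ?mul0r ?dvdz0 // mulNr dvdzE abszN -dvdzE.
have e : form x x = form p p + form q q - 2 * form p q.
  by rewrite {1 2}xE !formE_lin (formC q p); ring.
have [/eqP pp|pp] := boolP (form p p == 0).
  have [h|h] := form_null_support pp p0; [right|left]=> i; have := h i; rewrite mxE; lia.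
have [/eqP qq|qq] := boolP (form q q == 0).
  have [h|h] := form_null_support qq q0; [left|right]=> i; have := h i; rewrite mxE; lia.
have large (u : Q X) : (form x x %| form u u)%Z -> form u u != 0 ->
    form x x <= form u u.
  case/dvdzP => k ek u0; have : 0 < form u u by rewrite lt_def u0 form_ge0.
  by rewrite ek pmulr_lgt0 // => k0; rewrite ler_peMl // ltW.
have h1 := large p hp pp; have h2 := large q hq qq.
lia.
Qed.

End Sign.

(** * Simple roots of the subsystem *)

(** The roots obtained from the simple roots in Delta^t by the parabolic
    subgroup W_I, where I is the set of the simple roots outside Delta^t. *)
Inductive para_orbit (X : affine_type) (t : nat) : Q X -> Prop :=
  | para_base j : (j <= rank X)%N -> (t %| sqlen X j)%N ->
      para_orbit t (simple_root X j)
  | para_refl i b : (i <= rank X)%N -> ~~ (t %| sqlen X i)%N ->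
      para_orbit t b -> para_orbit t (refl (simple_root X i) b).

(** P is the W_I-orbit of the simple roots in Delta^t. *)
Record para_set (X : affine_type) (t : nat) (P : seq (Q X)) : Prop := ParaSet {
  para_set_simple : forall j, (j <= rank X)%N -> (t %| sqlen X j)%N ->
    simple_root X j \in P;
  para_set_stable : forall i, (i <= rank X)%N -> ~~ (t %| sqlen X i)%N ->
    {in P, forall b, refl (simple_root X i) b \in P};
  para_set_orbit : {in P, forall b, para_orbit t b} }.

Definition has_gram (X : affine_type) (T : subtype) (P : seq (Q X)) : Prop :=
  exists (s : seq (Q X)) (c : rat),
    [/\ perm_eq s P, size s = subtype_size T, 0 < c
      & forall i j, (i < subtype_size T)%N -> (j < subtype_size T)%N ->
          (form s`_i s`_j)%:~R = c * (subtype_gram T i j)%:~R].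

Lemma subtype_gram_diag T i : 0 < subtype_gram T i i.
Proof. by case: T => [Y|n] /=; rewrite ?eqxx gram_diag ltz_nat sqlen_gt0. Qed.

Lemma subtype_gram_le0 T i j : i != j -> subtype_gram T i j <= 0.
Proof.
case: T => [Y|n] ij /=; first exact: gram_le0.
by case: eqP => // e; apply: gram_le0; apply: contra ij; lia.
Qed.

Section Subsystem.
Variables (X : affine_type) (t : nat).
Hypothesis hX : valid X.
Implicit Types (x y b : Q X) (P : seq (Q X)).
Local Notation s := (simple_root X).

Lemma coordBZ x y (c : int) k : (x - c *: y) 0 k = x 0 k - c * y 0 k.
Proof. by do 3!rewrite mxE. Qed.

Lemma sub_rootE x : real_root x -> sub_root t x <-> (t%:Z %| form x x)%Z.
Proof. by move=> rx; split=> [[]//|h]; split=> //; left. Qed.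

Lemma sub_root_simple j : (j <= rank X)%N -> sub_root t (s j) <-> (t %| sqlen X j)%N.
Proof.
by move=> hj; rewrite sub_rootE ?form_simple ?gram_diag ?dvdzE //; apply: real_simple.
Qed.

(** Distinct vectors of a base have nonpositive products, so a repetition
    would make a positive length nonpositive. *)
Lemma has_gram_uniq T P : has_gram T P -> uniq P.
Proof.
case=> u [c [hp hs c0 h]]; rewrite -(perm_uniq hp); apply/(uniqP 0) => i j.
rewrite !inE hs => hi hj e; apply/eqP/negPn/negP => ij.
have := h i j hi hj; rewrite -e h // => /(mulfI (lt0r_neq0 c0))/eqP.
rewrite eqr_int => /eqP e'.
by have := subtype_gram_diag T i; rewrite e' ltNge subtype_gram_le0.
Qed.

Lemma para_orbit_real b : para_orbit t b -> real_root b.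
Proof.
elim=> [j hj _|i y hi _ _]; first exact: real_simple.
exact/real_refl/real_simple.
Qed.

Lemma para_orbit_sub b : para_orbit t b -> sub_root t b.
Proof.
move=> hb; apply/(sub_rootE (para_orbit_real hb)).
elim: hb => [j hj|i y hi _ _ IH]; first by rewrite form_simple // gram_diag dvdzE.
by rewrite form_refl //; apply: integral_simple.
Qed.

(** Reflections in the elements of I change only the coordinates in I. *)
Lemma para_orbit_coord b : para_orbit t b ->
  exists i : 'I_(rank X).+1,
    [/\ sub_root t (s i), b 0 i = 1
      & forall j : 'I_(rank X).+1, j != i -> sub_root t (s j) -> b 0 j = 0].
Proof.
elim=> [j hj dj|i y hi di _ [k [sk yk yj]]].
  have jE : (inord j : 'I_(rank X).+1) = j :> nat by rewrite inordK.
  exists (inord j); split=> [||k kj _]; first by rewrite jE; apply/sub_root_simple.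
    by rewrite simple_rootE /= jE eqxx.
  rewrite simple_rootE; case: eqP => // e; case/eqP: kj.
  by apply: val_inj; rewrite /= jE.
have hik (k' : 'I_(rank X).+1) : sub_root t (s k') -> s i 0 k' = 0.
  move=> h; rewrite simple_rootE; case: eqP => // e; case/negP: di.
  by apply/(sub_root_simple hi); rewrite -e.
exists k; have [c _ ->] := integralP y (integral_simple hi).
by split=> // [|j jk sj]; rewrite coordBZ hik // mulr0 subr0 // yj.
Qed.

Lemma para_orbit_pos b : para_orbit t b -> forall i, 0 <= b 0 i.
Proof.
move=> hb; have [//|h] := real_root_sign hX (para_orbit_real hb).
by have [i [_ bi _]] := para_orbit_coord hb; have := h i; rewrite bi.
Qed.

Lemma nonneg_comb0 P : nonneg_comb P 0.
Proof. by exists (fun=> 0%N); rewrite big1. Qed.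

Lemma nonneg_combD P x y :
  nonneg_comb P x -> nonneg_comb P y -> nonneg_comb P (x + y).
Proof.
case=> c -> [d ->]; exists (fun b => c b + d b)%N; rewrite -big_split.
by apply: eq_bigr => b _; rewrite mulrnDr.
Qed.

Lemma nonneg_combMn P x n : nonneg_comb P x -> nonneg_comb P (x *+ n).
Proof.
move=> h; elim: n => [|n IH]; first by rewrite mulr0n; apply: nonneg_comb0.
by rewrite mulrS; apply: nonneg_combD.
Qed.

Lemma nonneg_comb_mem P b : uniq P -> b \in P -> nonneg_comb P b.
Proof.
move=> uP bP; exists (fun b' => b' == b); rewrite (bigD1_seq b) //= eqxx.
by rewrite big1 ?addr0 // => b' /negbTE ->.
Qed.

Lemma nonneg_comb_refl P a x : integral a -> uniq P ->
  {in P, forall b, refl a b \in P} -> nonneg_comb P x -> nonneg_comb P (refl a x).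
Proof.
move=> ha uP hP [c ->]; rewrite big_seq.
apply: (big_ind (fun y => nonneg_comb P (refl a y))).
- by rewrite refl_fixed ?form0l //; apply: nonneg_comb0.
- by move=> u v hu hv; rewrite reflD //; apply: nonneg_combD.
by move=> b /hP bP; rewrite -scaler_nat reflZ // scaler_nat;
   apply/nonneg_combMn/nonneg_comb_mem.
Qed.

(** Because (x, x) is the sum of the x_i (x, a_i). *)
Lemma pos_simple x : 0 < form x x -> (forall i, 0 <= x 0 i) ->
  exists i : 'I_(rank X).+1, 0 < form x (s i).
Proof.
move=> x0 hx; apply/existsP; move: x0; apply: contraLR.
rewrite negb_exists => /forallP h; rewrite -leNgt {2}[x]simple_root_sum form_sumr.
apply: sumr_le0 => i _; rewrite formZr mulr_ge0_le0 //.
by rewrite leNgt.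
Qed.

(** Descent on the height: a positive root x of Delta^t that is not simple has
    (x, a_i) > 0 for some i, and s_i x is a lower positive root of Delta^t.
    If a_i lies in Delta^t, then x is s_i x plus a multiple of a_i; otherwise
    s_i permutes P, and the expression of s_i x is carried to one of x. *)
Lemma para_set_pos_comb P : para_set t P -> uniq P ->
  forall x, real_root x -> sub_root t x -> (forall i, 0 <= x 0 i) ->
  nonneg_comb P x.
Proof.
move=> [hsimple hstable _] uP x.
pose ht (y : Q X) := \sum_i y 0 i.
have [n] := ubnP (absz (ht x)); elim: n x => // n IH x hn rx sx hx.
have [i xi] := pos_simple (real_integral rx).1 hx.
have hi : (i <= rank X)%N by rewrite -ltnS.
have hs := integral_simple hi.
have [/existsP[l /andP[li xl]]|] := boolP [exists l, (l != i) && (x 0 l != 0)].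
  (* s_i changes only the coordinate i, so a second coordinate in the support
     of x keeps s_i x positive. *)
  have [k ek e] := integralP x hs.
  have k0 : 0 < k.
    by rewrite -(pmulr_lgt0 _ hs.1) -ek; rewrite pmulr_rgt0.
  set y := refl (s i) x in e *.
  have ry : real_root y by apply: real_refl => //; apply: real_simple.
  have sy : sub_root t y.
    by apply/(sub_rootE ry); rewrite form_refl //; apply/(sub_rootE rx).
  have yl : 0 < y 0 l.
    rewrite e coordBZ simple_rootE.
    case: eqP => [/val_inj h|_]; first by rewrite h eqxx in li.
    by rewrite mulr0 subr0 lt_def xl hx.
  have hy : forall j, 0 <= y 0 j.
    have [//|h] := real_root_sign hX ry.
    by have := h l; rewrite leNgt yl.
  have hlt : ht y < ht x.
    have -> : ht y = ht x - k.
      rewrite /ht e; under eq_bigr => j _ do rewrite coordBZ simple_rootE.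
      rewrite sumrB (bigD1 i) //= [X in _ - X](bigD1 i) //= eqxx mulr1.
      rewrite [X in _ - (_ + X)]big1 ?addr0 // => j ji.
      by case: eqP => [/val_inj/eqP|_]; rewrite ?mulr0 ?(negbTE ji).
    by rewrite ltrBlDr ltrDl.
  have cy : nonneg_comb P y.
    have ht_ge0 (z : Q X) : (forall j, 0 <= z 0 j) -> 0 <= ht z.
      by move=> hz; apply: sumr_ge0.
    by apply: IH => //; move: (ht_ge0 y hy) (ht_ge0 x hx) hn hlt; lia.
  case: (boolP (t %| sqlen X i)%N) => di; last first.
    rewrite -[x](reflK hs); apply: nonneg_comb_refl => //; exact: hstable.
  have -> : x = y + s i *+ `|k|%N.
    by rewrite e -scaler_nat natz gez0_abs ?ltW // subrK.
  apply: nonneg_combD => //; apply/nonneg_combMn/nonneg_comb_mem => //.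
  exact: hsimple.
(* Otherwise x is a multiple of a_i, hence equal to it. *)
rewrite negb_exists => /forallP h.
have xE : x = x 0 i *: s i.
  rewrite {1}[x]simple_root_sum (bigD1 i) //= big1 ?addr0 // => l li.
  by have := h l; rewrite li negbK => /eqP ->; rewrite scale0r.
have xi1 : x 0 i = 1 by have := real_primitive rx xE; have := hx i; lia.
move: xE; rewrite xi1 scale1r => xE; rewrite xE in sx *.
by apply: nonneg_comb_mem => //; apply: hsimple => //; apply/sub_root_simple.
Qed.

(** W(P)P contains the simple roots in Delta^t, and it is stable under all
    simple reflections: those in I permute P, the others belong to W(P). *)
Lemma para_set_weyl P : para_set t P ->
  forall x, sub_root t x /\ real_root x <-> weyl_orbit P x.
Proof.
move=> [hsimple hstable horbit] x.
have hP : {in P, forall b, integral b}.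
  by move=> b /horbit /para_orbit_real/real_integral.
split=> [[sx rx]|].
  move: sx; rewrite (sub_rootE rx); move: x rx; apply: real_ind => [i hi|i x hi rx IH].
    rewrite form_simple // gram_diag dvdzE => di.
    exact/weyl_orbit_base/hsimple.
  have hs := integral_simple hi; rewrite form_refl // => /IH.
  apply: weyl_orbit_stable => // b bP.
  have [di|di] := boolP (t %| sqlen X i)%N.
    apply: weyl_orbit_refl; [exact: hsimple | exact: weyl_orbit_base].
  by apply: weyl_orbit_base; apply: hstable.
elim=> [b /horbit hb|b y /horbit hb _ [sy ry]].
  by split; [apply: para_orbit_sub | apply: para_orbit_real].
have rb := para_orbit_real hb; have r := real_refl rb ry.
split=> //; apply/(sub_rootE r); rewrite form_refl; last exact: real_integral.
exact/(sub_rootE ry).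
Qed.

Lemma para_set_has_type T P : para_set t P -> has_gram T P ->
  has_type (@sub_root X t) T P /\ minimal (@sub_root X t) P.
Proof.
move=> hP hG; have uP := has_gram_uniq hG; have [_ _ horbit] := hP.
split; last by move=> b /horbit /para_orbit_coord.
split=> //.
- move=> b /horbit hb; split; [exact: para_orbit_sub | exact: para_orbit_real].
- by move=> b /horbit; apply: para_orbit_pos.
- exact: para_set_weyl.
move=> x sx rx; have [h|h] := real_root_sign hX rx; [left | right].
  exact: para_set_pos_comb.
have e := refl_self (real_integral rx).
have rN : real_root (- x) by rewrite -e; apply: real_refl.
apply: para_set_pos_comb => // [|i]; last by rewrite mxE oppr_ge0.
apply/(sub_rootE rN); rewrite formNl formNr opprK; exact/(sub_rootE rx).
Qed.

(** * The trivial cases *)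

Lemma isotropic_form x : isotropic_root x -> form x x = 0.
Proof.
case=> d [k [[h _ _] _ ->]]; rewrite formZl formZr.
suff -> : form d d = 0 by rewrite !mulr0.
by rewrite /form -mulmxA h mulmx0 mxE.
Qed.

Lemma trivial_subP : trivial_sub X t <->
  (forall i, (i <= rank X)%N -> (t %| sqlen X i)%N) \/
  (forall i, (i <= rank X)%N -> ~~ (t %| sqlen X i)%N).
Proof.
split=> [[h|h]|[h|h]].
- left=> i hi; apply/(sub_root_simple hi)/h; left; exact: real_simple.
- right=> i hi; apply/negP => /(sub_root_simple hi)/h/isotropic_form/eqP.
  by rewrite form_simple // gram_diag eqz_nat gtn_eqF ?sqlen_gt0.
- left=> x; split=> [[]//|ax]; split=> //.
  case: ax => [/real_length[i hi ->]|/isotropic_form ->]; last exact: dvdz0.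
  by rewrite dvdzE h.
right=> x [[/real_length[i hi ->]|//]].
by rewrite dvdzE (negbTE (h i hi)).
Qed.

End Subsystem.

Lemma sqlen_le8 (X : affine_type) i : (sqlen X i <= 8)%N.
Proof. by case: X => //= *; do ?case: ifP. Qed.

Lemma exceptional_gt8 (X : affine_type) t : (8 < t)%N -> exceptional X t = None.
Proof.
by do 9?[case: t => [|t] //]; case: X => [n|n|n|n||||||[|[|[|n]]]|n||||n].
Qed.

(** In the cases of the table, multiples of t and other numbers occur among
    the lengths of the nodes 0, 1 and n. *)
Lemma exceptional_None (X : affine_type) t : valid X ->
  (forall i, (i <= rank X)%N -> (t %| sqlen X i)%N) \/
  (forall i, (i <= rank X)%N -> ~~ (t %| sqlen X i)%N) <->
  exceptional X t = None.
Proof.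
move=> hX; have [t9|t9] := ltnP 8 t.
  rewrite exceptional_gt8 //; split=> // _; right=> i _.
  rewrite gtnNdvd ?sqlen_gt0 //.
  exact: leq_ltn_trans (sqlen_le8 X i) t9.
case: X hX => [[|n]|[|n]|[|[|n]]|[|n]||||||[|[|[|n]]]|[|n]||||[|n]] // hX;
  do 9?[case: t t9 => [|t] // t9];
  first
  [ by split=> // _; left=> i _ /=; do ?case: ifP
  | by split=> // _; right=> i _ /=; do ?case: ifP
  | by split=> // [[h|h]]; move: (h 0%N isT) (h 1%N isT) (h _ (leqnn _));
       rewrite /= ?eqxx ].
Qed.

(** * Single diagrams in coordinates *)

Section Coordinates.
Variable X : affine_type.
Implicit Types (u v : seq int).
Local Notation s := (simple_root X).
Local Notation nodes := (iota 0 (rank X).+1).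

Definition vec u : Q X := \row_j u`_j.

Definition cunit (i : nat) : seq int := [seq (j == i)%:R | j <- nodes].
Definition cadd u v : seq int := [seq u`_j + v`_j | j <- nodes].
Definition cmul u n : seq int := [seq u`_j *+ n | j <- nodes].
Definition csum (F : nat -> int) : int := foldr (fun j c => F j + c) 0 nodes.
Definition cform u v : int :=
  csum (fun i => csum (fun j => u`_i * gram X i j * v`_j)).
Definition crefl u v : seq int :=
  let k := divz (2 * cform v u) (cform u u) in [seq v`_j - k * u`_j | j <- nodes].

Lemma vec_nth (F : nat -> int) (j : 'I_(rank X).+1) :
  vec [seq F i | i <- nodes] 0 j = F j.
Proof. by rewrite mxE (nth_map 0%N) ?size_iota // nth_iota. Qed.

Lemma vec_unit i : s i = vec (cunit i).
Proof. by apply/rowP => j; rewrite simple_rootE vec_nth. Qed.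

Lemma vec_add u v : vec u + vec v = vec (cadd u v).
Proof. by apply/rowP => j; rewrite vec_nth !mxE. Qed.

Lemma vec_mul u n : vec u *+ n = vec (cmul u n).
Proof. by apply/rowP => j; rewrite vec_nth -scaler_nat !mxE mulr_natl. Qed.

Lemma csumE (F : nat -> int) : \sum_(i < (rank X).+1) F i = csum F.
Proof. exact: sum_foldr. Qed.

Lemma form_vec u v : form (vec u) (vec v) = cform u v.
Proof.
rewrite formE /cform -csumE; apply: eq_bigr => i _.
by rewrite -csumE; apply: eq_bigr => j _; rewrite !mxE.
Qed.

Lemma refl_vec u v : refl (vec u) (vec v) = vec (crefl u v).
Proof. by apply/rowP => j; rewrite vec_nth /refl !form_vec coordBZ !mxE. Qed.

(** A certificate for one row: the coordinates U of P, an order o of U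
    realizing the Gram matrix of T rescaled by c, and for each element of U a
    word w and a node j with element s_w a_j. *)
Definition row_check (t : nat) (T : subtype) (U : seq (seq int)) (o : seq nat)
    (W : seq (seq nat * nat)) (c : nat) : bool :=
  let V := [seq nth [::] U k | k <- o] in
  [&& all (fun j => (t %| sqlen X j)%N ==> (cunit j \in U)) nodes,
      all (fun i => (t %| sqlen X i)%N ||
                    all (fun u => crefl (cunit i) u \in U) U) nodes,
      all (fun p => all (fun i => (i \in nodes) && ~~ (t %| sqlen X i)%N) p.1 &&
                    (p.2 \in nodes) && (t %| sqlen X p.2)%N) W,
      [seq foldr (fun i => crefl (cunit i)) (cunit p.2) p.1 | p <- W] == U
    & [&& perm_eq V U, size V == subtype_size T, (0 < c)%N
       & all (fun i => all (fun j => cform (nth [::] V i) (nth [::] V j) ==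
                c%:Z * subtype_gram T i j)
              (iota 0 (subtype_size T))) (iota 0 (subtype_size T))]].

Lemma row_checkP t T U o W c : row_check t T U o W c ->
  para_set t [seq vec u | u <- U] /\ has_gram T [seq vec u | u <- U].
Proof.
have nodesP i : (i \in nodes) = (i <= rank X)%N by rewrite mem_iota add0n ltnS.
rewrite /row_check; set V := [seq _ | k <- o].
case/and5P => /allP h1 /allP h2 /allP h3 /eqP h4 /and4P[h5 /eqP h6 h7 /allP h8].
split; first split.
- move=> j hj dj; rewrite vec_unit map_f //.
  by have := h1 j; rewrite nodesP hj dj; apply.
- move=> i hi di _ /mapP[u uU ->]; rewrite vec_unit refl_vec map_f //.
  by have := h2 i; rewrite nodesP hi (negbTE di) => /(_ isT)/allP; apply.
- move=> _ /mapP[u + ->]; rewrite -h4 => /mapP[[w j] /h3 /= /andP[/andP[hw hj] dj] ->].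
  rewrite nodesP in hj; elim: w hw => [|i w IH] /=.
    by rewrite -vec_unit => _; apply: para_base.
  case/andP => /andP[hi di] /IH hw; rewrite -refl_vec -vec_unit.
  by apply: para_refl => //; rewrite -nodesP.
exists [seq vec u | u <- V], c%:R; split; rewrite ?ltr0n ?perm_map //.
  by rewrite size_map.
move=> i j hi hj; rewrite !(nth_map [::]) ?h6 // form_vec.
have := h8 i; rewrite mem_iota hi => /(_ isT)/allP/(_ j).
by rewrite mem_iota hj => /(_ isT)/eqP ->; rewrite rmorphM.
Qed.

End Coordinates.

Definition row_ok (X : affine_type) (t : nat) : Prop :=
  forall (T : subtype) (P : seq (Q X)),
    exceptional X t = Some (T, P) -> para_set t P /\ has_gram T P.

(** The order o puts the elements of P in the positions of the nodes of T; it is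
    not the identity when they are listed in another order than the nodes. *)
Ltac by_row U o W c :=
  let V := fresh "U" in
  move=> ? ? [<- <-]; rewrite /=; pose V : seq (seq int) := U;
  match goal with |- para_set (X := ?X) ?t ?P /\ _ =>
    have -> : P = [seq vec X u | u <- V] by
      rewrite !vec_unit ?(@vec_mul X, @vec_add X); reflexivity
  end;
  apply: (row_checkP (o := o) (W := W) (c := c)); vm_compute; reflexivity.

Lemma row_Bt1_3 : row_ok (Bt1 3) 4.
Proof.
by_row
  [:: [:: 1; 0; 0; 0]; [:: 0; 1; 0; 0]; [:: 0; 0; 1; 0]; [:: 0; 0; 1; 2 : int]]
  [:: 0; 2; 1; 3]%N [:: ([::], 0); ([::], 1); ([::], 2); ([:: 3], 2)]%N 2%N.
Qed.

Lemma row_F4t1 : row_ok F4t1 4.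
Proof.
by_row
  [:: [:: 1; 0; 0; 0; 0]; [:: 0; 1; 0; 0; 0]; [:: 0; 0; 1; 0; 0];
      [:: 0; 0; 1; 2; 0]; [:: 0; 0; 1; 2; 2 : int]]
  [:: 0; 2; 1; 3; 4]%N
  [:: ([::], 0); ([::], 1); ([::], 2); ([:: 3], 2); ([:: 4; 3], 2)]%N 2%N.
Qed.

Lemma row_G2t1 t : (t == 3)%N || (t == 6)%N -> row_ok G2t1 t.
Proof.
by case/orP => /eqP ->;
  by_row [:: [:: 1; 0; 0]; [:: 0; 1; 0]; [:: 0; 1; 3 : int]] [:: 0; 1; 2]%N
         [:: ([::], 0); ([::], 1); ([:: 2], 1)]%N 3%N.
Qed.

Lemma row_Dt2_2 : row_ok (Dt2 2) 4.
Proof.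
by_row
  [:: [:: 0; 1; 0]; [:: 0; 1; 2]; [:: 2; 1; 0]; [:: 2; 1; 2 : int]]
  [:: 0; 3; 1; 2]%N
  [:: ([::], 1); ([:: 2], 1); ([:: 0], 1); ([:: 2; 0], 1)]%N 2%N.
Qed.

Lemma row_Dt2_3 : row_ok (Dt2 3) 4.
Proof.
by_row
  [:: [:: 2; 1; 0; 0]; [:: 0; 1; 0; 0]; [:: 0; 0; 1; 0]; [:: 0; 0; 1; 2 : int]]
  [:: 0; 2; 1; 3]%N [:: ([:: 0], 1); ([::], 1); ([::], 2); ([:: 3], 2)]%N 2%N.
Qed.

Lemma row_E6t2 : row_ok E6t2 4.
Proof.
by_row
  [:: [:: 2; 2; 2; 1; 0]; [:: 0; 0; 0; 0; 1]; [:: 0; 0; 0; 1; 0];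
      [:: 0; 0; 2; 1; 0]; [:: 0; 2; 2; 1; 0 : int]]
  [:: 0; 2; 1; 3; 4]%N
  [:: ([:: 0; 1; 2], 3); ([::], 4); ([::], 3); ([:: 2], 3); ([:: 1; 2], 3)]%N
  2%N.
Qed.

Lemma row_D4t3 t : (t == 3)%N || (t == 6)%N -> row_ok D4t3 t.
Proof.
by case/orP => /eqP ->;
  by_row [:: [:: 3; 3; 1]; [:: 0; 0; 1]; [:: 0; 3; 1 : int]] [:: 0; 1; 2]%N
         [:: ([:: 0; 1], 2); ([::], 2); ([:: 1], 2)]%N 3%N.
Qed.

Lemma row_A2t2 t : (t == 4)%N || (t == 8)%N -> row_ok A2t2 t.
Proof.
by case/orP => /eqP ->;
  by_row [:: [:: 4; 1]; [:: 0; 1 : int]] [:: 0; 1]%N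
         [:: ([:: 0], 1); ([::], 1)]%N 4%N.
Qed.

Lemma row_At2even_2 : row_ok (At2even 2) 4.
Proof.
by_row [:: [:: 2; 1; 0]; [:: 0; 1; 0]; [:: 0; 0; 1 : int]] [:: 0; 2; 1]%N
       [:: ([:: 0], 1); ([::], 1); ([::], 2)]%N 2%N.
Qed.

Lemma subtype_gramC T i j : subtype_gram T i j = subtype_gram T j i.
Proof. by case: T => [Y|n] /=; rewrite gramC // eq_sym. Qed.

Lemma has_gram_mkseq (X : affine_type) T (f : nat -> Q X) (c : nat) : (0 < c)%N ->
  (forall i j, (i <= j)%N -> (j < subtype_size T)%N ->
     form (f i) (f j) = c%:Z * subtype_gram T i j) ->
  has_gram T (mkseq f (subtype_size T)).
Proof.
move=> c0 h; exists (mkseq f (subtype_size T)), c%:R.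
split; rewrite ?size_mkseq ?ltr0n // => i j hi hj; rewrite !nth_mkseq //.
have [ij|/ltnW ji] := leqP i j; first by rewrite h // rmorphM.
by rewrite formC h // rmorphM subtype_gramC.
Qed.

Lemma has_gram_perm (X : affine_type) T (P P' : seq (Q X)) :
  perm_eq P P' -> has_gram T P -> has_gram T P'.
Proof.
move=> hP [s [c [h1 h2 h3 h4]]]; exists s, c; split=> //.
exact: perm_trans h1 hP.
Qed.

Lemma perm_interleave (T : eqType) (f g : nat -> T) n :
  perm_eq (mkseq (fun i => if odd i then g i./2 else f i./2) n.*2)
          (mkseq f n ++ mkseq g n).
Proof.
elim: n => // n IH; rewrite doubleS !mkseqS /= odd_double /= uphalf_double doubleK.
rewrite -!cats1; apply/permP => a; have := permP IH a.
by rewrite !count_cat /=; lia.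
Qed.

(** * Powers of A_1^(1) *)

(** The nodes 1, ..., n form a diagram of type C_n, the form being multiplied
    by k. In the usual coordinates, a_i is e_i - e_(i+1) for i < n, and a_n is
    2 e_n. *)
Definition C_chain (X : affine_type) (k : nat) : Prop :=
  forall i j, (0 < i <= j)%N -> (j <= rank X)%N ->
  gram X i j = if i == j then (if i == rank X then 4 else 2) * k%:Z
               else if i.+1 == j then - ((if j == rank X then 2 else 1) * k%:Z)
               else 0.

Section Families.
Variable X : affine_type.
Variable t : nat.
Variable k : nat.
Variable b : Q X.
Local Notation s := (simple_root X).
Local Notation n := (rank X).

(** These are 2 e_j and, for b as below, c delta - 2 e_j with c independent
    of j. *)
Definition upper (j : nat) : Q X := s n + (\sum_(j <= i < n) s i) *+ 2.
Definition lower (j : nat) : Q X := b + (\sum_(1 <= i < j) s i) *+ 2.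

Lemma upper_last : upper n = s n.
Proof. by rewrite /upper big_geq // mul0rn addr0. Qed.

Lemma upperS j : (j < n)%N -> upper j = upper j.+1 + s j *+ 2.
Proof. by move=> h; rewrite /upper big_ltn // mulrnDl [_ *+ 2 + _ *+ 2]addrC addrA. Qed.

Lemma upper_ind (T : nat -> Prop) : T n ->
  (forall j, (0 < j < n)%N -> T j.+1 -> T j) -> forall j, (0 < j <= n)%N -> T j.
Proof.
move=> h0 hS j /andP[j0 jn]; rewrite -(subKn jn); have : (n - j < n)%N by lia.
elim: (n - j)%N => [|d IH] hd; first by rewrite subn0.
apply: hS; first by lia.
have -> : ((n - d.+1).+1 = n - d)%N by lia.
by apply: IH; lia.
Qed.

Lemma lower_upper j : (0 < j <= n)%N -> lower j = b + upper 1 - upper j.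
Proof.
move=> hj; rewrite /lower /upper.
rewrite (big_cat_nat (n := j) (m := 1) (p := n)) /=; [|lia|lia].
by rewrite mulrnDl -[RHS]addrA; congr (_ + _); rewrite addrCA addrK.
Qed.

Hypothesis k_gt0 : (0 < k)%N.
Hypothesis n_gt1 : (1 < n)%N.
Hypothesis gram_chain : C_chain X k.
(** That is, b has the form c delta - 2 e_1. *)
Hypothesis null : forall i, (i <= n)%N -> form (b + upper 1) (s i) = 0.

Lemma form_upper_chain j i : (0 < j <= n)%N -> (0 < i < n)%N ->
  form (upper j) (s i) = (if i == j then 2 else if i.+1 == j then - 2 else 0) * k%:Z.
Proof.
move=> hj hi; move: j hj; apply: upper_ind => [|j hj IH].
  rewrite upper_last form_simple; [|lia|lia].
  rewrite gramC gram_chain; [|lia|lia].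
  by repeat (case: eqP => ?); lia.
rewrite upperS; last by lia.
rewrite formDl formMnl {}IH form_simple; [|lia|lia].
have [ij|ij] := leqP i j; [rewrite gramC|]; rewrite gram_chain; try lia.
  by repeat (case: eqP => ?); lia.
by repeat (case: eqP => ?); lia.
Qed.

Lemma form_upper_last j : (0 < j <= n)%N ->
  form (upper j) (s n) = (if j == n then 4 else 0) * k%:Z.
Proof.
move: j; apply: upper_ind => [|j hj IH].
  by rewrite upper_last form_simple // gram_chain ?eqxx; lia.
rewrite upperS; last by lia.
rewrite formDl formMnl {}IH form_simple; [|lia|lia].
rewrite gram_chain; [|lia|lia].
by repeat (case: eqP => ?); lia.
Qed.

Lemma form_upper i j : (0 < i <= n)%N -> (0 < j <= n)%N ->
  form (upper i) (upper j) = (if i == j then 4 else 0) * k%:Z.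
Proof.
move=> hi hj; move: j hj; apply: upper_ind => [|j hj IH].
  by rewrite upper_last form_upper_last.
rewrite [upper j]upperS; last by lia.
rewrite formDr formMnr {}IH form_upper_chain; [|lia|lia].
by repeat (case: eqP => ?); lia.
Qed.

Local Notation delta := (b + upper 1).

Lemma form_delta x : form delta x = 0.
Proof.
rewrite [x]simple_root_sum form_sumr big1 // => i _.
by rewrite formZr null ?mulr0 // -ltnS.
Qed.

Lemma form_upper_lower i j : (0 < i <= n)%N -> (0 < j <= n)%N ->
  form (upper i) (lower j) = - (if i == j then 4 else 0) * k%:Z.
Proof.
move=> hi hj; rewrite lower_upper // formBr formC form_delta form_upper //.
by rewrite sub0r mulNr.
Qed.

Lemma form_lower i j : (0 < i <= n)%N -> (0 < j <= n)%N ->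
  form (lower i) (lower j) = (if i == j then 4 else 0) * k%:Z.
Proof.
move=> hi hj; rewrite [lower i]lower_upper // formBl form_delta.
by rewrite form_upper_lower // sub0r mulNr opprK.
Qed.

Definition families : seq (Q X) := upper_family s n ++ lower_family s n b.

Lemma families_mkseq :
  families = rev (mkseq (fun i => upper i.+1) n) ++ mkseq (fun i => lower i.+1) n.
Proof.
by rewrite /families /upper_family /lower_family map_rev /mkseq (iotaDl 1 0) -!map_comp.
Qed.

Lemma families_gram : has_gram (A1pow n) families.
Proof.
apply: (has_gram_perm (P := mkseq (fun i => if odd i then lower i./2.+1
   else upper i./2.+1) n.*2)).
  have := perm_interleave (fun i => upper i.+1) (fun i => lower i.+1) n.
  move/perm_trans; apply; rewrite families_mkseq perm_cat2r perm_sym.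
  by rewrite (perm_rev (mkseq (fun i => upper i.+1) n)).
(* The roots have length 4k, those of A_1^(1) have length 2. *)
apply: (has_gram_mkseq (T := A1pow n) (c := 2 * k)%N) => [|i j ij /= hj]; first by lia.
have hi : (0 < i./2.+1 <= n)%N by lia.
have {}hj : (0 < j./2.+1 <= n)%N by lia.
have -> : gram (At1 1) (odd i) (odd j) = if odd i == odd j then 2 else -2.
  by case: (odd i); case: (odd j).
case: (odd i); case: (odd j); rewrite ?form_lower ?form_upper ?form_upper_lower //.
all: try rewrite formC form_upper_lower //.
all: repeat (case: eqP => ?); lia.
Qed.

Definition swap (i j : nat) : nat :=
  if j == i then i.+1 else if j == i.+1 then i else j.

Lemma swap_bound i j : (0 < i < n)%N -> (0 < j <= n)%N -> (0 < swap i j <= n)%N.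
Proof. by rewrite /swap => hi hj; do ?case: ifP => _; lia. Qed.

(** The chain acts on the upper and lower families by adjacent transpositions,
    which permute the coordinates e_j. *)
Lemma refl_upper i j : (0 < i < n)%N -> (0 < j <= n)%N ->
  refl (s i) (upper j) = upper (swap i j).
Proof.
move=> hi hj; have ii : integral (s i) by apply: integral_simple; lia.
have e := form_upper_chain hj hi.
have l : form (s i) (s i) = 2 * k%:Z.
  by rewrite form_simple ?gram_chain ?eqxx; try lia; case: eqP; lia.
rewrite /swap; case: eqP => [ji|ji].
  rewrite ji eqxx in e; rewrite (refl_exact (k := 2)) ?(integral_neq0 ii) //.
    by rewrite ji upperS ?scaler_nat ?addrK //; lia.
  by rewrite ji e l.
case: eqP => [ji'|ji'].
  have ne : (i == j) = false by lia.
  rewrite ne ji' eqxx in e; rewrite (refl_exact (k := - 2)) ?(integral_neq0 ii) //.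
    by rewrite ji' [upper i]upperS ?scaleNr ?opprK ?scaler_nat //; lia.
  by rewrite ji' e l; lia.
have ne : (i == j) = false by lia.
have ne' : (i.+1 == j) = false by lia.
by rewrite refl_fixed // e ne ne' mul0r.
Qed.

Lemma refl_delta_sub i x : (i <= n)%N ->
  refl (s i) (delta - x) = delta - refl (s i) x.
Proof.
move=> hi; have ii := integral_simple hi.
by rewrite reflD // reflN // (refl_fixed (form_delta _)).
Qed.

Lemma refl_lower i j : (0 < i < n)%N -> (0 < j <= n)%N ->
  refl (s i) (lower j) = lower (swap i j).
Proof.
move=> hi hj; rewrite lower_upper // refl_delta_sub ?refl_upper //; last by lia.
by rewrite lower_upper // swap_bound.
Qed.

Lemma mem_families x : x \in families <->
  exists2 j, (0 < j <= n)%N & x = upper j \/ x = lower j.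
Proof.
rewrite families_mkseq mem_cat mem_rev; split=> [/orP[]/mapP[j]|[[|j] // hj [->|->]]].
- by rewrite mem_iota => hj ->; exists j.+1; [lia | left].
- by rewrite mem_iota => hj ->; exists j.+1; [lia | right].
- by apply/orP; left; apply/mapP; exists j; rewrite ?mem_iota.
by apply/orP; right; apply/mapP; exists j; rewrite ?mem_iota.
Qed.

Hypothesis last_in : (t %| sqlen X n)%N.
Hypothesis chain_out : forall i, (0 < i < n)%N -> ~~ (t %| sqlen X i)%N.
(** If a_0 is outside Delta^t, then s_0 has to permute the two families, and
    it must link the lower one to a_n, the only simple root in Delta^t. *)
Hypothesis zero :
  if (t %| sqlen X 0)%N then b = s 0%N else
  (exists2 j, (0 < j <= n)%N & lower 1 = refl (s 0%N) (upper j)) /\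
  forall j, (0 < j <= n)%N -> refl (s 0%N) (upper j) = upper j \/
    exists2 i, (0 < i <= n)%N & refl (s 0%N) (upper j) = lower i.

Lemma upper_orbit j : (0 < j <= n)%N -> para_orbit t (upper j).
Proof.
move: j; apply: upper_ind => [|j hj IH]; first by rewrite upper_last; apply: para_base.
have -> : upper j = refl (s j) (upper j.+1).
  by rewrite refl_upper; try lia; rewrite /swap; repeat (case: eqP => ?); try lia.
by apply: para_refl IH; [lia | apply: chain_out].
Qed.

Lemma lower_orbit j : (0 < j <= n)%N -> para_orbit t (lower j).
Proof.
elim: j => // -[_ _|j IH hj].
  move: zero; case: ifPn => d0.
    by rewrite /lower big_geq // mul0rn addr0 => ->; apply: para_base.
  by case=> -[j hj -> _]; apply: para_refl => //; apply: upper_orbit.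
have -> : lower j.+2 = refl (s j.+1) (lower j.+1).
  by rewrite refl_lower; try lia; rewrite /swap eqxx.
by apply: para_refl; [lia | apply: chain_out; lia | apply: IH; lia].
Qed.

Lemma families_stable i : (i <= n)%N -> ~~ (t %| sqlen X i)%N ->
  {in families, forall x, refl (s i) x \in families}.
Proof.
move=> hi di x /mem_families[j hj xj]; apply/mem_families.
have i_n : i <> n by move=> e; rewrite e last_in in di.
case: i hi di i_n => [|i] hi di i_n.
  move: zero; rewrite (negbTE di) => -[_ /(_ j hj) h].
  case: xj h => -> [h|[i hi' h]].
  - by exists j => //; left.
  - by exists i => //; right.
  - by exists j => //; right; rewrite lower_upper // refl_delta_sub // h.
  exists i => //; left; rewrite lower_upper // refl_delta_sub // h lower_upper //.
  by rewrite subKr.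
have {}hi : (0 < i.+1 < n)%N by lia.
exists (swap i.+1 j); first exact: swap_bound.
by case: xj => ->; rewrite ?refl_upper ?refl_lower //; [left | right].
Qed.

Lemma families_row : para_set t families /\ has_gram (A1pow n) families.
Proof.
split; last exact: families_gram; split.
- move=> j hj dj; apply/mem_families; have [->|jn] := eqVneq j n.
    by exists n; [lia | left; rewrite upper_last].
  have [j0|j0] := posnP j; last by have := @chain_out j; rewrite dj; lia.
  exists 1%N; first by lia.
  right; move: dj zero; rewrite j0 => ->.
  by rewrite /lower big_geq // mul0rn addr0.
- exact: families_stable.
by move=> x /mem_families[j hj [->|->]]; [apply: upper_orbit | apply: lower_orbit].
Qed.

End Families.

Ltac gram_at X i j :=
  first
  [ rewrite (@gram_nonadjacent X i j); [ | lia | edge_lia]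
  | rewrite (@gram_adjacent X i j); [ | by [] | lia | edge_lia]
  | replace j with i by lia; rewrite (gram_diag X i) ].

(** Evaluates Gram matrix entries whose position relative to the diagonal and
    to the ends of the diagram is determined by linear hypotheses. *)
Ltac gram_all :=
  repeat match goal with |- context [gram ?X ?i ?j] => gram_at X i j end;
  rewrite /sqlen /=; repeat (case: ifP => ?); lia.

(** * The position of the node 0 in a power of A_1^(1) *)

Section ZeroNode.
Variable X : affine_type.
Local Notation s := (simple_root X).
Local Notation n := (rank X).

Lemma form_upper_zero (f : nat -> int) :
  f n = gram X 0 n ->
  (forall j, (0 < j < n)%N -> f j = f j.+1 + 2 * gram X 0 j) ->
  forall j, (0 < j <= n)%N -> form (upper X j) (s 0) = f j.
Proof.
move=> f0 fS; apply: upper_ind => [|j hj IH].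
  by rewrite upper_last form_simple // gramC.
rewrite upperS; last by lia.
rewrite formDl formMnl IH form_simple //; last by lia.
by rewrite gramC (fS j) //; lia.
Qed.


Hypothesis n_gt1 : (1 < n)%N.

Lemma C_chain_sqlen k i : C_chain X k -> (0 < i <= n)%N ->
  sqlen X i = ((if i == n then 4 else 2) * k)%N.
Proof.
move=> hC hi; have := hC i i; rewrite gram_diag eqxx => h.
by have := h ltac:(lia) ltac:(lia); case: eqP; lia.
Qed.

(** Node 0 as in C_n^(1): here a_0 is delta - 2 e_1. *)
Lemma families_long : C_chain X 1 ->
  (forall j, (j <= n)%N ->
     gram X 0 j = if j == 0%N then 4 else if j == 1%N then -2 else 0) ->
  para_set 4 (families (s 0%N)) /\ has_gram (A1pow n) (families (s 0%N)).
Proof.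
move=> hC g0.
have h0 j : (0 < j <= n)%N -> form (upper X j) (s 0%N) = if (j <= 1)%N then -4 else 0.
  move: j; apply: (form_upper_zero (f := fun j => if (j <= 1)%N then -4 else 0)).
    by rewrite g0 //; do ?case: ifP; lia.
  by move=> j hj; rewrite g0; last lia; do ?case: ifP; lia.
apply: (families_row (k := 1)) => // [i hi|||].
- rewrite formDl form_simple // g0 //.
  have [i0|i0] := posnP i; first by rewrite i0 h0 //; lia.
  have [->|i_n] := eqVneq i n.
    by rewrite (form_upper_last (k := 1)) //; last lia; do ?case: ifP; lia.
  by rewrite (form_upper_chain (k := 1)) //; [do ?case: ifP; lia|lia|lia].
- by rewrite (C_chain_sqlen hC) ?eqxx //; lia.
- move=> i hi; rewrite (C_chain_sqlen hC); last by lia.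
  by rewrite ltn_eqF //; lia.
have := g0 0%N isT; rewrite gram_diag => -[->] //.
Qed.

(** Node 0 as in A_{2n-1}^(2): here a_0 is delta - e_1 - e_2, so s_0 exchanges
    2 e_1 with 2 delta - 2 e_2, and 2 e_2 with 2 delta - 2 e_1. *)
Lemma families_fork : (2 < n)%N -> C_chain X 1 ->
  (forall j, (j <= n)%N ->
     gram X 0 j = if j == 0%N then 2 else if j == 2%N then -1 else 0) ->
  let b := s 0%N *+ 2 + (\sum_(2 <= i < n) s i) *+ 2 + s n in
  para_set 4 (families b) /\ has_gram (A1pow n) (families b).
Proof.
move=> n_gt2 hC g0 b.
have h0 j : (0 < j <= n)%N -> form (upper X j) (s 0%N) = if (j <= 2)%N then -2 else 0.
  move: j; apply: (form_upper_zero (f := fun j => if (j <= 2)%N then -2 else 0)).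
    by rewrite g0 //; do ?case: ifP; lia.
  by move=> j hj; rewrite g0; last lia; do ?case: ifP; lia.
have bE : b = upper X 2 + s 0%N *+ 2.
  by rewrite /b /upper -[LHS]addrA [LHS]addrC; congr (_ + _); apply: addrC.
have l0 : form (s 0%N) (s 0%N) = 2 by rewrite form_simple // g0.
have i0 : integral (s 0%N) by apply: integral_simple.
have refl12 j : (j <= 2)%N -> (0 < j <= n)%N ->
    refl (s 0%N) (upper X j) = lower b (3 - j).
  move=> j2 hj; rewrite (refl_exact (k := -2)) ?(integral_neq0 i0) //; last first.
    by rewrite h0 // j2 l0.
  rewrite scaleNr opprK scaler_nat bE /lower.
  (* For j = 1, 2 the image of 2 e_j is 2 delta - 2 e_(3 - j). *)
  have [->|->] : j = 1%N \/ j = 2%N by lia.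
    by rewrite upperS ?big_nat1 1?addrAC //; lia.
  by rewrite big_geq // mul0rn addr0.
apply: (families_row (k := 1)) => // [i hi|||].
- rewrite bE 2!formDl formMnl form_simple // g0 //.
  have [i0'|i0'] := posnP i; first by rewrite i0' !h0 //; lia.
  have [->|i_n] := eqVneq i n.
    by rewrite !(form_upper_last (k := 1)) //; [do ?case: ifP; lia|lia..].
  by rewrite !(form_upper_chain (k := 1)) //; [do ?case: ifP; lia|lia..].
- by rewrite (C_chain_sqlen hC) ?eqxx //; lia.
- move=> i hi; rewrite (C_chain_sqlen hC); last by lia.
  by rewrite ltn_eqF //; lia.
have := g0 0%N isT; rewrite gram_diag => -[->] /=.
split; first by exists 2%N; [lia | rewrite refl12 //; lia].
move=> j hj; have [j2|j2] := leqP j 2%N.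
  by right; exists (3 - j)%N; [lia | rewrite refl12].
by left; rewrite refl_fixed // h0 // leqNgt j2.
Qed.

(** Node 0 as in A_{2n}^(2): here a_0 is delta / 2 - e_1, so s_0 exchanges
    2 e_1 and 2 delta - 2 e_1. *)
Lemma families_short : C_chain X 2 ->
  (forall j, (j <= n)%N ->
     gram X 0 j = if j == 0%N then 2 else if j == 1%N then -2 else 0) ->
  let b := (s 0%N *+ 2 + s 1%N) *+ 2 + (\sum_(2 <= i < n) s i) *+ 2 + s n in
  para_set 8 (families b) /\ has_gram (A1pow n) (families b).
Proof.
move=> hC g0 b.
have h0 j : (0 < j <= n)%N -> form (upper X j) (s 0%N) = if (j <= 1)%N then -4 else 0.
  move: j; apply: (form_upper_zero (f := fun j => if (j <= 1)%N then -4 else 0)).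
    by rewrite g0 //; do ?case: ifP; lia.
  by move=> j hj; rewrite g0; last lia; do ?case: ifP; lia.
have bE : b = upper X 1 + s 0%N *+ 4.
  rewrite /b /upper [in RHS]big_ltn // (mulrnDl 2 (s 0%N *+ 2)).
  rewrite (mulrnDl 2 (s 1%N)) -(mulrnA (s 0%N) 2 2) [RHS]addrC -[LHS]addrA -[LHS]addrA.
  by congr (_ + _); rewrite [RHS]addrC; apply: addrA.
have l0 : form (s 0%N) (s 0%N) = 2 by rewrite form_simple // g0.
have i0 : integral (s 0%N) by apply: integral_simple.
have refl1 : refl (s 0%N) (upper X 1) = lower b 1.
  rewrite (refl_exact (k := -4)) ?(integral_neq0 i0) //; last first.
    by rewrite h0 ?l0 //; lia.
  by rewrite /lower big_geq // mul0rn addr0 bE scaleNr opprK scaler_nat.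
apply: (families_row (k := 2)) => // [i hi|||].
- rewrite bE 2!formDl formMnl form_simple // g0 //.
  have [i0'|i0'] := posnP i; first by rewrite i0' !h0 //; lia.
  have [->|i_n] := eqVneq i n.
    by rewrite !(form_upper_last (k := 2)) //; [do ?case: ifP; lia|lia..].
  by rewrite !(form_upper_chain (k := 2)) //; [do ?case: ifP; lia|lia..].
- by rewrite (C_chain_sqlen hC) ?eqxx //; lia.
- move=> i hi; rewrite (C_chain_sqlen hC); last by lia.
  by rewrite ltn_eqF //; lia.
have := g0 0%N isT; rewrite gram_diag => -[->] /=.
split; first by exists 1%N; [lia | rewrite refl1].
move=> j hj; have [j1|j1] := leqP j 1%N.
  have -> : j = 1%N by lia.
  by right; exists 1%N; [lia | rewrite refl1].
by left; rewrite refl_fixed // h0 // leqNgt j1.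
Qed.

End ZeroNode.

Ltac C_chain_gram :=
  let i := fresh "i" in let j := fresh "j" in
  move=> i j /= ? ?; case: (eqVneq i j) => [?|?];
  [ gram_all | case: (eqVneq i.+1 j) => [?|?]; gram_all ].

Lemma row_Ct1 n : (2 <= n)%N -> row_ok (Ct1 n) 4.
Proof.
move=> hn T P [<- <-]; apply: (families_long (X := Ct1 n)) => //.
  by C_chain_gram.
move=> j /= hj; case: (eqVneq j 0%N) => [?|?]; first by gram_all.
by case: (eqVneq j 1%N) => [?|?]; gram_all.
Qed.

Lemma row_At2odd n : (3 <= n)%N -> row_ok (At2odd n) 4.
Proof.
move=> hn T P [<- <-]; apply: (families_fork (X := At2odd n)) => //.
- exact: ltnW.
- by C_chain_gram.
move=> j /= hj; case: (eqVneq j 0%N) => [?|?]; first by gram_all.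
by case: (eqVneq j 2%N) => [?|?]; gram_all.
Qed.

Lemma row_At2even_8 n : (2 <= n)%N -> row_ok (At2even n) 8.
Proof.
move=> hn T P [<- <-]; apply: (families_short (X := At2even n)) => //.
  by C_chain_gram.
move=> j /= hj; case: (eqVneq j 0%N) => [?|?]; first by gram_all.
by case: (eqVneq j 1%N) => [?|?]; gram_all.
Qed.

(** * Reflections at the ends of the diagram *)

Section Ends.
Variable X : affine_type.
Local Notation s := (simple_root X).

Lemma refl_simple i j (m : nat) : (i <= rank X)%N -> (j <= rank X)%N ->
  2 * gram X j i = - (m%:Z * gram X i i) -> refl (s i) (s j) = s j + s i *+ m.
Proof.
move=> hi hj e; have ii := integral_simple hi.
rewrite (refl_exact (k := - m%:Z)) ?(integral_neq0 ii) //.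
  by rewrite scaleNr opprK -natz scaler_nat.
by rewrite !form_simple // e mulNr.
Qed.

Lemma refl_simple_fixed i j : (i <= rank X)%N -> (j <= rank X)%N ->
  gram X j i = 0 -> refl (s i) (s j) = s j.
Proof. by move=> hi hj e; rewrite refl_fixed // form_simple. Qed.

End Ends.

(** Expand a product of combinations of two simple roots at most, then
    evaluate the entries of both Gram matrices. *)
Ltac form_all :=
  rewrite ?(formDl, formDr) ?(formMnl, formMnr) !form_simple; [|by rewrite /=; lia..];
  gram_all.

(** The root s_n a_(n-1) = a_(n-1) + 2 a_n is orthogonal to a_(n-1) and takes
    the place of the node n of D_n^(1). *)
Lemma row_Bt1 n : (4 <= n)%N -> row_ok (Bt1 n) 4.
Proof.
move=> hn T P [<- <-]; set s := simple_root (Bt1 n).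
have n1 : (n.-1 < n)%N by lia.
have reflw : refl (s n) (s n.-1) = s n.-1 + s n *+ 2.
  by apply: refl_simple => //=; [lia | gram_all].
pose f i := if (i < n)%N then s i else s n.-1 + s n *+ 2.
have fP : [seq s i | i <- iota 0 n] ++ [:: s n.-1 + s n *+ 2] = mkseq f n.+1.
  rewrite mkseqS /f ltnn -cats1; congr (_ ++ _).
  by apply/eq_in_map => i; rewrite mem_iota => /= ->.
have fE i : (i < n)%N -> f i = s i by rewrite /f => ->.
have fn : f n = s n.-1 + s n *+ 2 by rewrite /f ltnn.
have inP i : (i <= n)%N -> f i \in mkseq f n.+1.
  by move=> hi; apply: map_f; rewrite mem_iota.
have in_n : integral (s n) by apply: integral_simple.
rewrite fP; split.
  split.
  - move=> j /= hj; case: (eqVneq j n) => [->|jn _] //.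
    by rewrite -[simple_root _ _]fE ?inP //; lia.
  - move=> i /= hi; have [-> _ b|] := eqVneq i n; last by rewrite dvdnn.
    case/mapP => j; rewrite mem_iota => hj ->.
    have [->|j_n] := eqVneq j n.
      by rewrite fn -reflw reflK // -fE ?inP //; lia.
    rewrite fE; last by lia.
    have [->|jn1] := eqVneq j n.-1; first by rewrite reflw -fn inP.
    have -> : refl (s n) (s j) = s j.
      by apply: refl_simple_fixed => /=; [|lia|gram_all].
    by rewrite -fE ?inP //; lia.
  move=> _ /mapP[j + ->]; rewrite mem_iota => hj.
  have [->|j_n] := eqVneq j n.
    rewrite fn -reflw; apply: para_refl; rewrite /= ?eqxx //.
    by apply: para_base => /=; [lia | rewrite ltn_eqF].
  rewrite fE; last by lia.
  by apply: para_base => /=; [lia | rewrite (negbTE j_n)].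
have -> : D1_type n = Dt1 n by rewrite /D1_type gtn_eqF.
apply: (has_gram_mkseq (T := Conn (Dt1 n)) (c := 2)) => // i j ij /= hj.
have [jn|jn] := ltnP j n.
  rewrite !fE //; last by lia.
  case: (eqVneq i j) => [?|?]; first by form_all.
  case: (posnP i) => [?|?]; first by case: (eqVneq j 2%N) => [?|?]; form_all.
  by case: (eqVneq i.+1 j) => [?|?]; form_all.
have {jn}j_n : j = n by lia.
have [i_n|i_n] := ltnP i n; last first.
  by have -> : i = n; [lia | rewrite j_n fn; form_all].
rewrite j_n fn fE //.
case: (eqVneq i n.-1) => [?|?]; first by form_all.
by case: (eqVneq i.+2 n) => [?|?]; form_all.
Qed.

(** The roots s_0 a_1 and s_n a_(n-1) take the places of the nodes 0 and n of
    D_n^(1). *)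
Lemma row_Dt2 n : (4 <= n)%N -> row_ok (Dt2 n) 4.
Proof.
move=> hn T P; set s := simple_root (Dt2 n).
have -> : exceptional (Dt2 n) 4 = Some (Conn (D1_type n),
    s 0%N *+ 2 + s 1%N :: [seq s i | i <- iota 1 n.-1] ++ [:: s n.-1 + s n *+ 2]).
  by rewrite /s; case: n hn {s T P} => [|[|[|n]]].
case=> <- <-.
have refl0 : refl (s 0%N) (s 1%N) = s 0%N *+ 2 + s 1%N.
  by rewrite addrC; apply: refl_simple => //=; [lia | gram_all].
have refln : refl (s n) (s n.-1) = s n.-1 + s n *+ 2.
  by apply: refl_simple => //=; [lia | gram_all].
pose f i := if i == 0%N then s 0%N *+ 2 + s 1%N
            else if (i < n)%N then s i else s n.-1 + s n *+ 2.
have f0 : f 0%N = s 0%N *+ 2 + s 1%N by [].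
have fn : f n = s n.-1 + s n *+ 2 by rewrite /f ltnn gtn_eqF //; lia.
have fE i : (0 < i < n)%N -> f i = s i.
  by case/andP=> h1 h2; rewrite /f h2 gtn_eqF.
have -> : s 0%N *+ 2 + s 1%N :: [seq s i | i <- iota 1 n.-1] ++
    [:: s n.-1 + s n *+ 2] = mkseq f n.+1.
  rewrite -fn -[s 0%N *+ 2 + s 1%N]f0 mkseqS -cats1 -cat_cons; congr (_ ++ _).
  have iotaE m : (0 < m)%N -> iota 0 m = 0%N :: iota 1 m.-1 by case: m.
  rewrite /mkseq iotaE; last by lia.
  congr (_ :: _); apply/eq_in_map => i; rewrite mem_iota => hi.
  by rewrite fE //; lia.
have inP i : (i <= n)%N -> f i \in mkseq f n.+1.
  by move=> hi; apply: map_f; rewrite mem_iota.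
have i0 : integral (s 0%N) by apply: integral_simple.
have in_n : integral (s n) by apply: integral_simple.
split.
  split.
  - move=> j /= hj; case: (eqVneq j 0%N) => [->|j0] //=.
    case: (eqVneq j n) => [->|jn _] //.
    by rewrite -[simple_root _ _]fE ?inP //; lia.
  - move=> i /= hi di _ /mapP[j + ->]; rewrite mem_iota => hj.
    have {di} : i = 0%N \/ i = n by move: di; case: ifP => // /orP[]/eqP; auto.
    have s_fixed k l : (k <= n)%N -> (l <= n)%N -> gram (Dt2 n) l k = 0 ->
        refl (s k) (s l) = s l.
      by move=> hk hl; apply: refl_simple_fixed.
    case=> ->; have [->|j0] := eqVneq j 0%N; rewrite ?f0.
    + by rewrite -refl0 reflK // -fE ?inP //; lia.
    + have [->|j_n] := eqVneq j n; rewrite ?fn.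
        rewrite refl_fixed -?fn ?inP // fn.
        by form_all.
      rewrite fE; last by lia.
      have [->|j1] := eqVneq j 1%N; first by rewrite refl0 -f0 inP.
      have -> : refl (s 0%N) (s j) = s j by apply: s_fixed; [|lia|gram_all].
      by rewrite -fE ?inP //; lia.
    + rewrite refl_fixed -?f0 ?inP // f0.
      by form_all.
    have [->|j_n] := eqVneq j n; rewrite ?fn.
      by rewrite -refln reflK // -fE ?inP //; lia.
    rewrite fE; last by lia.
    have [->|jn1] := eqVneq j n.-1; first by rewrite refln -fn inP.
    have -> : refl (s n) (s j) = s j by apply: s_fixed; [|lia|gram_all].
    by rewrite -fE ?inP //; lia.
  have base j : (0 < j < n)%N -> para_orbit (X := Dt2 n) 4 (s j).
    by move=> hj; apply: para_base => /=; [lia | rewrite gtn_eqF ?ltn_eqF //; lia].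
  move=> _ /mapP[j + ->]; rewrite mem_iota => hj.
  have [->|j0] := eqVneq j 0%N.
    by rewrite f0 -refl0; apply: para_refl => //; apply: base; lia.
  have [->|j_n] := eqVneq j n.
    rewrite fn -refln; apply: para_refl; rewrite /= ?eqxx ?orbT //.
    by apply: base; lia.
  by rewrite fE; [apply: base|]; lia.
have -> : D1_type n = Dt1 n by rewrite /D1_type gtn_eqF.
apply: (has_gram_mkseq (T := Conn (Dt1 n)) (c := 2)) => // i j ij /= hj.
have [i0'|i0'] := posnP i.
  rewrite i0' f0; have [j0|j0] := posnP j; first by rewrite j0 f0; form_all.
  have [j_n|j_n] := eqVneq j n; first by rewrite j_n fn; form_all.
  rewrite fE; last by lia.
  case: (eqVneq j 1%N) => [?|?]; first by form_all.
  by case: (eqVneq j 2%N) => [?|?]; form_all.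
have [jn|jn] := ltnP j n.
  rewrite !fE; [|lia|lia].
  case: (eqVneq i j) => [?|?]; first by form_all.
  by case: (eqVneq i.+1 j) => [?|?]; form_all.
have {jn}j_n : j = n by lia.
have [i_n|i_n] := ltnP i n; last first.
  by have -> : i = n; [lia | rewrite j_n fn; form_all].
rewrite j_n fn fE; last by lia.
case: (eqVneq i n.-1) => [?|?]; first by form_all.
by case: (eqVneq i.+2 n) => [?|?]; form_all.
Qed.

(** The root s_0 a_1 takes the place of the node 0 of A_{2n-1}^(2). *)
Lemma row_At2even_4 n : (3 <= n)%N -> row_ok (At2even n) 4.
Proof.
move=> hn T P [<- <-]; set s := simple_root (At2even n).
have refl0 : refl (s 0%N) (s 1%N) = s 0%N *+ 2 + s 1%N.
  by rewrite addrC; apply: refl_simple => //=; [lia | gram_all].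
pose f i := if i == 0%N then s 0%N *+ 2 + s 1%N else s i.
have f0 : f 0%N = s 0%N *+ 2 + s 1%N by [].
have fE i : (0 < i)%N -> f i = s i by rewrite /f; case: posnP.
have -> : s 0%N *+ 2 + s 1%N :: [seq s i | i <- iota 1 n] = mkseq f n.+1.
  by congr (_ :: _); apply/eq_in_map => i; rewrite mem_iota => /andP[/fE ->].
have inP i : (i <= n)%N -> f i \in mkseq f n.+1.
  by move=> hi; apply: map_f; rewrite mem_iota.
have i0 : integral (s 0%N) by apply: integral_simple.
have d4 j : (0 < j)%N -> (4 %| sqlen (At2even n) j)%N.
  by move=> /= /gtn_eqF ->; case: ifP.
split.
  split.
  - by move=> [|j] //= hj _; rewrite -[simple_root _ _]fE ?inP.
  - move=> [|i] hi di; last by rewrite d4 in di.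
    move=> _ /mapP[j + ->]; rewrite mem_iota => hj.
    have [->|j0] := posnP j; first by rewrite f0 -refl0 reflK // -fE ?inP //; lia.
    rewrite fE //; have [->|j1] := eqVneq j 1%N; first by rewrite refl0 -f0 inP.
    have -> : refl (s 0%N) (s j) = s j.
      by apply: refl_simple_fixed => /=; [|lia|gram_all].
    by rewrite -fE ?inP.
  have base j : (0 < j <= n)%N -> para_orbit (X := At2even n) 4 (s j).
    by move=> hj; apply: para_base; [rewrite /=; lia | apply: d4; lia].
  move=> _ /mapP[j + ->]; rewrite mem_iota => hj.
  have [->|j0] := posnP j; last by rewrite fE //; apply: base; lia.
  by rewrite f0 -refl0; apply: para_refl => //; apply: base; lia.
have -> : A2odd_type n = At2odd n by rewrite /A2odd_type gtn_eqF.
apply: (has_gram_mkseq (T := Conn (At2odd n)) (c := 2)) => // i j ij /= hj.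
have [i0'|i0'] := posnP i.
  rewrite i0' f0; have [j0|j0] := posnP j; first by rewrite j0 f0; form_all.
  rewrite fE //; case: (eqVneq j 1%N) => [?|?]; first by form_all.
  by case: (eqVneq j 2%N) => [?|?]; form_all.
rewrite !fE; [|lia|lia].
case: (eqVneq i j) => [?|?]; first by form_all.
by case: (eqVneq i.+1 j) => [?|?]; form_all.
Qed.

(** * The table *)

Lemma exceptional_rows (X : affine_type) t : valid X -> row_ok X t.
Proof.
(* Only t <= 8 and, for the series, small n have to be distinguished. *)
have [/exceptional_gt8 e _ T P|] := ltnP 8 t; first by rewrite e.
do 9?[case: t => [|t] //] => _.
all: case: X => [n|[|[|[|[|n]]]]|n|n||||||[|[|[|[|n]]]]|n||||[|[|[|n]]]] // hX.
all: try by move=> T P.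
all: first
  [ exact: row_Bt1_3 | exact: row_Bt1 | exact: row_Ct1 | exact: row_F4t1
  | exact: row_G2t1 | exact: row_Dt2_2 | exact: row_Dt2_3 | exact: row_Dt2
  | exact: row_At2odd | exact: row_E6t2 | exact: row_D4t3 | exact: row_A2t2
  | exact: row_At2even_2 | exact: row_At2even_4 | exact: row_At2even_8 ].
Qed.

Theorem theorem3p3 (X : affine_type) (hX : valid X) (t : nat) :
  (trivial_sub X t <-> exceptional X t = None) /\
  (forall (T : subtype) (P : seq (Q X)),
     exceptional X t = Some (T, P) ->
     has_type (@sub_root X t) T P /\ minimal (@sub_root X t) P).
Proof.
split; first by rewrite trivial_subP; apply: exceptional_None.
move=> T P /(exceptional_rows hX)[hP hG]; exact: para_set_has_type.
Qed.
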